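(* Assume $c\notin\{a,b\}$. For $i\in\mathbb{Z}\setminus\{1,\dots,N\}$ let $F_i$ be the $F$-polynomial of the Gale–Robinson cluster variable $x_i$. Then for all $j>0$ $$F_{1-j}=\sum_{R\in\mathcal{F}(S^{(j)})}\ \prod_{\lambda\in R}y_{a\lambda_1+b\lambda_2-c\lambda_3-d\lambda_4+(N+1-j)}$$ and $$F_{N+j}=\sum_{I\in J(S^{(j)})}\ \prod_{\lambda\in I}y_{-a\lambda_1-b\lambda_2+c\lambda_3+d\lambda_4+j}.$$ In particular, under the specialization $x_1=x_2=\cdots=x_N=1$, one has $x_{N+j}=|J(S^{(j)})|$ for $j>0$.
   Context: Fix positive integers $a,b,c,d$ with $a+b=c+d=N$ and $\gcd(a,c,N)=1$. The Gale–Robinson quiver $Q$ has vertex set $\{1,\dots,N\}$; for vertices $i,j$ the number of arrows $i\to j$ equals the number of the following conditions that hold: $j=i+a$; $j=i+b$; $j=i-c$; $j=i-d$; $j=i+a-c$ with $i+a>N$, $i-c<1$; $j=i+a-d$ with $i+a>N$, $i-d<1$; $j=i+b-c$ with $i+b>N$, $i-c<1$; $j=i+b-d$ with $i+b>N$, $i-d<1$. Consider the cluster algebra with initial seed $(Q,(x_1,\dots,x_N))$ (2-cycles of $Q$ being irrelevant for the seed). The Gale–Robinson cluster variables $x_i$, $i>N$ or $i\le0$, are defined by the recurrence $x_ix_{i+N}=x_{i+a}x_{i+N-a}+x_{i+c}x_{i+N-c}$; $x_{N+j}$ ($j>0$) is obtained by the mutation sequence $1,2,\dots,j$ (indices mod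 $N$) and $x_{1-j}$ by $N,N-1,\dots,N-j+1$. $F_i$ denotes the $F$-polynomial (in the sense of Fomin–Zelevinsky, in variables $y_1,\dots,y_N$) of $x_i$ with respect to this initial seed, and each $x_i$ is a Laurent polynomial in $x_1,\dots,x_N$. $S^{(j)}=\{\lambda\in\mathbb{Z}^4:\ j-N\le a\lambda_1+b\lambda_2-c\lambda_3-d\lambda_4\le j-1,\ \lambda_1,\lambda_2\ge0,\ \lambda_3,\lambda_4\le0\}$, a finite poset under the componentwise order. $\mathcal{F}(P)$ is the set of order filters of a poset $P$ (subsets closed upward within $P$) and $J(P)$ the set of order ideals (subsets closed downward within $P$). *)

(* Defs.v *)
From mathcomp Require Import all_boot all_order all_algebra.
From mathcomp Require Import finmap zify ring.
From mathcomp Require Import fraction.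
From mathcomp.multinomials Require Import mpoly.

Set Implicit Arguments.
Unset Strict Implicit.
Unset Printing Implicit Defensive.

Import Order.TTheory GRing.Theory Num.Theory.
Local Open Scope fset_scope.
Local Open Scope ring_scope.

(** * Seeds of geometric type *)

(* A seed has N mutable variables, followed by p frozen ones. *)
Record seed (K : fieldType) (N p : nat) := Seed {
  exchange_matrix : 'M[int]_(N + p, N);
  extended_cluster : 'rV[K]_(N + p)
}.

Definition pos_part (b : int) : nat := absz (Num.max 0 b).

Definition mutate_matrix (N p : nat) (k : 'I_N) (B : 'M[int]_(N + p, N)) :
    'M[int]_(N + p, N) :=
  \matrix_(i, j)
    if (i == lshift p k) || (j == k) then - B i j
    else B i j + (pos_part (B i k) * pos_part (B (lshift p k) j))%:Z
               - (pos_part (- B i k) * pos_part (- B (lshift p k) j))%:Z.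

Definition mutate_cluster (K : fieldType) (N p : nat) (k : 'I_N)
    (B : 'M[int]_(N + p, N)) (z : 'rV[K]_(N + p)) : 'rV[K]_(N + p) :=
  \row_i
    if i == lshift p k then
      (\prod_l z 0 l ^+ pos_part (B l k) + \prod_l z 0 l ^+ pos_part (- B l k))
        / z 0 (lshift p k)
    else z 0 i.

Definition mutate (K : fieldType) (N p : nat) (s : seed K N p) (k : 'I_N) :
    seed K N p :=
  Seed (mutate_matrix k (exchange_matrix s))
       (mutate_cluster k (exchange_matrix s) (extended_cluster s)).

(* The mutable variable at vertex k of the seed reached from s by mutating at
   the vertices of path, in the order in which they are listed. *)
Definition variable_after (K : fieldType) (N p : nat) (s : seed K N p)
    (path : seq 'I_N) (k : 'I_N) : K :=
  extended_cluster (foldl (@mutate K N p) s path) 0 (lshift p k).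

(** * Coefficient-free and principal cluster variables, F-polynomials *)

Notation ratfun R N := {fraction {mpoly R[N]}}.

Definition init_cluster (R : idomainType) (N : nat) : 'rV[ratfun R N]_N :=
  \row_i tofrac 'X_i.

Definition trivial_seed (N : nat) (B : 'M[int]_N) : seed (ratfun int N) N 0 :=
  Seed (col_mx B 0) (row_mx (init_cluster int N) 0).

(* The ambient field is Frac(Z[y_1..y_N][x_1..x_N]); the frozen variables are
   the y_i, which are constants of the outer polynomial ring. *)
Definition principal_seed (N : nat) (B : 'M[int]_N) :
    seed (ratfun {mpoly int[N]} N) N N :=
  Seed (col_mx B 1%:M)
       (row_mx (init_cluster {mpoly int[N]} N) (\row_i tofrac ('X_i)%:MP)).

Definition cluster_variable (N : nat) (B : 'M[int]_N) :=
  variable_after (trivial_seed B).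

Definition principal_variable (N : nat) (B : 'M[int]_N) :=
  variable_after (principal_seed B).

(* The rational function z of x_1..x_N is defined at x_1 = ... = x_N = 1 and
   takes the value v there. *)
Definition at_ones (R : idomainType) (N : nat) (z : ratfun R N) (v : R) : Prop :=
  exists P Q : {mpoly R[N]},
    [/\ Q.@[fun=> 1] != 0, z * tofrac Q = tofrac P & v * Q.@[fun=> 1] = P.@[fun=> 1]].

Lemma at_ones_inj (R : idomainType) (N : nat) (z : ratfun R N) (v w : R) :
  at_ones z v -> at_ones z w -> v = w.
Proof.
move=> [P [Q [Q0 zQ vQ]]] [P' [Q' [Q'0 zQ' wQ']]].
have e : P * Q' = P' * Q.
  by apply/eqP; rewrite -tofrac_eq !tofracM -zQ -zQ' mulrAC.
have := congr1 (meval (fun=> 1)) e; rewrite !mevalM -vQ -wQ' => e1.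
by apply: (mulIf Q0); apply: (mulIf Q'0); rewrite e1 mulrAC.
Qed.

(** * The Gale-Robinson quiver *)

(* The vertices 1, ..., N, where N = n.+1, are represented by 'I_n.+1;
   vertex i is the one congruent to i mod N, and label is its inverse. *)
Definition vertex (n : nat) (i : int) : 'I_n.+1 :=
  inord (absz ((i - 1) %% n.+1%:Z)%Z).

Definition label (n : nat) (i : 'I_n.+1) : int := i.+1%:Z.

Definition gr_arrows (n a b c d : nat) (u v : 'I_n.+1) : nat :=
  let N := n.+1%:Z in let i := label u in let j := label v in
  ((j == i + a%:Z)%R + (j == i + b%:Z)%R
   + (j == i - c%:Z)%R + (j == i - d%:Z)%R
   + [&& j == i + a%:Z - c%:Z, N < i + a%:Z & i - c%:Z < 1]%R
   + [&& j == i + a%:Z - d%:Z, N < i + a%:Z & i - d%:Z < 1]%R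
   + [&& j == i + b%:Z - c%:Z, N < i + b%:Z & i - c%:Z < 1]%R
   + [&& j == i + b%:Z - d%:Z, N < i + b%:Z & i - d%:Z < 1]%R)%N.

(* Sign convention of Derksen-Weyman-Zelevinsky: b_uv > 0 counts arrows from v
   to u.  Cluster variables do not depend on it, but F-polynomials do: the
   opposite sign yields those of the opposite quiver. *)
Definition gr_matrix (n a b c d : nat) : 'M[int]_n.+1 :=
  \matrix_(u, v) ((gr_arrows a b c d v u)%:Z - (gr_arrows a b c d u v)%:Z).

(** * The Gale-Robinson recurrence *)

(* For k <= n, gr_up m k is x_{m+1+k} and gr_down m k is x_{1-m+k}. *)
Fixpoint gr_up (n a c m : nat) : nat -> ratfun int n.+1 :=
  if m is m'.+1 then
    let w := gr_up n a c m' in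
    fun k => if (k < n)%N then w k.+1
             else (w a * w (n.+1 - a)%N + w c * w (n.+1 - c)%N) / w 0%N
  else fun k => init_cluster int n.+1 0 (inord k).

Fixpoint gr_down (n a c m : nat) : nat -> ratfun int n.+1 :=
  if m is m'.+1 then
    let w := gr_down n a c m' in
    fun k => if k is k'.+1 then w k'
             else (w a.-1 * w (n.+1 - a).-1 + w c.-1 * w (n.+1 - c).-1) / w n
  else fun k => init_cluster int n.+1 0 (inord k).

Definition gr_var (n a c : nat) (i : int) : ratfun int n.+1 :=
  match i with
  | Posz m.+1 => gr_up n a c m 0
  | Posz 0 => gr_down n a c 1 0
  | Negz m => gr_down n a c m.+2 0
  end.

(* For i outside 1..N, gr_path i is 1, 2, .., j (indices mod N) if i = N + j, and
   N, N - 1, .., N - j + 1 if i = 1 - j; the last vertex mutated is vertex i. *)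
Definition gr_path (n : nat) (i : int) : seq 'I_n.+1 :=
  if n.+1%:Z < i
  then [seq vertex n k%:Z | k <- iota 1 (absz (i - n.+1%:Z))]
  else [seq vertex n (n.+1%:Z + 1 - k%:Z) | k <- iota 1 (absz (1 - i))].

(* The F-polynomial is attached to the seed in which x_i occurs: besides giving
   its value, we ask that the cluster variable found there is indeed x_i. *)
Definition is_gr_F_polynomial (n a b c d : nat) (i : int)
    (F : {mpoly int[n.+1]}) : Prop :=
  let B := gr_matrix n a b c d in
  cluster_variable B (gr_path n i) (vertex n i) = gr_var n a c i /\
  at_ones (principal_variable B (gr_path n i) (vertex n i)) F.

Definition yvar (n : nat) (k : int) : {mpoly int[n.+1]} := 'X_(vertex n k).

(** * The posets S^(j) *)

Notation quad := (int * int * int * int)%type.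

Definition weight (a b c d : nat) (l : quad) : int :=
  let: (l1, l2, l3, l4) := l in
  a%:Z * l1 + b%:Z * l2 - c%:Z * l3 - d%:Z * l4.

Definition quad_le (l m : quad) : bool :=
  let: (l1, l2, l3, l4) := l in
  let: (m1, m2, m3, m4) := m in
  [&& l1 <= m1, l2 <= m2, l3 <= m3 & l4 <= m4].

Definition nonnegs (j : nat) : {fset int} := [fset k%:Z | k in iota 0 j].
Definition nonposs (j : nat) : {fset int} := [fset - k%:Z | k in iota 0 j].

(* The box is large enough to contain all of S^(j): see in_gr_poset. *)
Definition gr_poset (N a b c d j : nat) : {fset quad} :=
  [fset l : quad in nonnegs j `*` nonnegs j `*` nonposs j `*` nonposs j
   | j%:Z - N%:Z <= weight a b c d l <= j%:Z - 1].

Lemma in_gr_poset (N a b c d j : nat) (l1 l2 l3 l4 : int) :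
  (0 < a)%N -> (0 < b)%N -> (0 < c)%N -> (0 < d)%N ->
  ((l1, l2, l3, l4) \in gr_poset N a b c d j) =
  [&& j%:Z - N%:Z <= a%:Z * l1 + b%:Z * l2 - c%:Z * l3 - d%:Z * l4 <= j%:Z - 1,
      0 <= l1, 0 <= l2, l3 <= 0 & l4 <= 0].
Proof.
move=> a0 b0 c0 d0.
have nn x : (x \in nonnegs j) = (0 <= x < j%:Z).
  apply/imfsetP/idP => /= [[k]|xj]; first by rewrite mem_iota => kj ->; lia.
  by exists `|x|%N; rewrite ?mem_iota; lia.
have np x : (x \in nonposs j) = (- j%:Z < x <= 0).
  apply/imfsetP/idP => /= [[k]|xj]; first by rewrite mem_iota => kj ->; lia.
  by exists `|x|%N; rewrite ?mem_iota; lia.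
rewrite !inE /= !nn !np /weight.
by apply/idP/idP => H; nia.
Qed.

Definition order_ideals (P : {fset quad}) : {fset {fset quad}} :=
  [fset I in fpowerset P |
    [forall u : P, forall v : P,
      (val v \in I) && quad_le (val u) (val v) ==> (val u \in I)]].

Definition order_filters (P : {fset quad}) : {fset {fset quad}} :=
  [fset R in fpowerset P |
    [forall u : P, forall v : P,
      (val u \in R) && quad_le (val u) (val v) ==> (val v \in R)]].

(** * The variables x_i satisfy the Gale-Robinson recurrence *)

Section Recurrence.
Variables n a c : nat.
Hypotheses (a0 : (0 < a)%N) (aN : (a < n.+1)%N).
Hypotheses (c0 : (0 < c)%N) (cN : (c < n.+1)%N).
Local Notation K := (ratfun int n.+1).
Local Notation x := (gr_var n a c).

Let positive (z : K) : Prop :=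
  exists P Q : {mpoly int[n.+1]},
    [/\ 0 < P.@[fun=> 1], 0 < Q.@[fun=> 1] & z * tofrac Q = tofrac P].

Let positive_neq0 z : positive z -> z != 0.
Proof.
move=> [P [Q [P0 _ zQ]]]; apply/eqP => z0; move: zQ; rewrite z0 mul0r.
move/eqP; rewrite eq_sym tofrac_eq0 => /eqP PE.
by move: P0; rewrite PE meval0 ltxx.
Qed.

Let positiveM z w : positive z -> positive w -> positive (z * w).
Proof.
move=> [P [Q [P0 Q0 zQ]]] [P' [Q' [P'0 Q'0 wQ]]].
exists (P * P'), (Q * Q'); split; rewrite ?mevalM ?mulr_gt0 //.
by rewrite !tofracM -zQ -wQ; ring.
Qed.

Let positiveD z w : positive z -> positive w -> positive (z + w).
Proof.
move=> [P [Q [P0 Q0 zQ]]] [P' [Q' [P'0 Q'0 wQ]]].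
exists (P * Q' + P' * Q), (Q * Q'); split.
- by rewrite mevalD !mevalM addr_gt0 ?mulr_gt0.
- by rewrite mevalM mulr_gt0.
by rewrite tofracD !tofracM -zQ -wQ; ring.
Qed.

Let positiveV z : positive z -> positive z^-1.
Proof.
move=> pz; have z0 := positive_neq0 pz.
move: pz => [P [Q [P0 Q0 zQ]]]; exists Q, P; split=> //.
by rewrite -zQ mulKf.
Qed.

Let positive_init i : positive (init_cluster int n.+1 0 i).
Proof.
exists 'X_i, 1; split; rewrite ?mevalXU ?meval1 //.
by rewrite mxE tofrac1 mulr1.
Qed.

Let positive_up m k : (k <= n)%N -> positive (gr_up n a c m k).
Proof.
elim: m k => [|m IH] k kn /=; first exact: positive_init.
case: ifP => kn'; first by apply: IH.
apply: positiveM; last by apply: positiveV; apply: IH.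
by apply: positiveD; apply: positiveM; apply: IH; lia.
Qed.

Let positive_down m k : (k <= n)%N -> positive (gr_down n a c m k).
Proof.
elim: m k => [|m IH] k kn /=; first exact: positive_init.
case: k kn => [|k] kn; last by apply: IH; lia.
apply: positiveM; last by apply: positiveV; apply: IH.
by apply: positiveD; apply: positiveM; apply: IH; lia.
Qed.

Lemma gr_upE m k : (k <= n)%N -> gr_up n a c m k = x (m + k).+1%:Z.
Proof.
elim: k m => [|k IH] m kn; first by rewrite addn0.
have -> : (m + k.+1 = m.+1 + k)%N by lia.
by rewrite -IH /= ?kn //; lia.
Qed.

Let gr_downE0 m : gr_down n a c m 0 = x (1 - m%:Z).
Proof.
case: m => [|[|m]]; rewrite ?subr0 ?subrr //.
by have -> : 1 - m.+2%:Z = Negz m by lia.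
Qed.

Lemma gr_downE m k : (k <= n)%N -> gr_down n a c m k = x (1 - m%:Z + k%:Z).
Proof.
elim: k m => [|k IH] m kn; first by rewrite addr0 gr_downE0.
case: m => [|m].
  have -> : 1 - 0%N%:Z + k.+1%:Z = (0 + k.+1).+1%:Z :> int by lia.
  by rewrite -gr_upE.
have -> : 1 - m.+1%:Z + k.+1%:Z = 1 - m%:Z + k%:Z :> int by lia.
by rewrite -IH //; lia.
Qed.

Lemma gr_var_init (i : 'I_n.+1) : x (label i) = tofrac 'X_i.
Proof.
rewrite /label -[nat_of_ord i]add0n -gr_upE; last by rewrite -ltnS.
by rewrite /= mxE inord_val.
Qed.

Lemma gr_var_recurrence (i : int) :
  x i * x (i + n.+1%:Z) =
    x (i + a%:Z) * x (i + n.+1%:Z - a%:Z) + x (i + c%:Z) * x (i + n.+1%:Z - c%:Z).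
Proof.
have [i0|i0] := ltP 0 i.
  have [m ->] : exists m, i = m.+1%:Z by exists (absz (i - 1)); lia.
  have := @gr_upE m.+1 n (leqnn n).
  have -> : (m.+1 + n).+1%:Z = m.+1%:Z + n.+1%:Z :> int by lia.
  rewrite [gr_up _ _ _ _ _]/= ltnn.
  have w k : (k <= n)%N -> gr_up n a c m k = x (m.+1%:Z + k%:Z).
    by move=> kn; rewrite gr_upE //; congr (gr_var _ _ _); lia.
  rewrite !w; try lia; rewrite addr0.
  have -> : m.+1%:Z + (n.+1 - a)%N%:Z = m.+1%:Z + n.+1%:Z - a%:Z :> int by lia.
  have -> : m.+1%:Z + (n.+1 - c)%N%:Z = m.+1%:Z + n.+1%:Z - c%:Z :> int by lia.
  move=> <-; rewrite mulrC divfK //.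
  by apply: positive_neq0; apply: (@positive_up m 0).
have [m ->] : exists m, i = 1 - m.+1%:Z by exists (absz i); lia.
have := @gr_downE m.+1 0 (leq0n n); rewrite /= addr0.
have w k : (k < n.+1)%N -> gr_down n a c m k = x (1 - m.+1%:Z + k.+1%:Z).
  by move=> kn; rewrite gr_downE //; congr (gr_var _ _ _); lia.
have wn := w n (leqnn _).
rewrite !w ?prednK; try lia.
have -> : 1 - m.+1%:Z + (n.+1 - a)%N%:Z = 1 - m.+1%:Z + n.+1%:Z - a%:Z :> int by lia.
have -> : 1 - m.+1%:Z + (n.+1 - c)%N%:Z = 1 - m.+1%:Z + n.+1%:Z - c%:Z :> int by lia.
move=> <-; rewrite divfK // -wn.
by apply: positive_neq0; apply: (@positive_down m n).
Qed.

End Recurrence.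

(* Main.v *)
(* Let Sigma_j(w) be the sum over the order ideals I of S^(j) of the product of the
   weights w_{j - weight(l)}, l in I.  The elements of S^(j+1) with label 1 form
   its top layer; replacing them by the bottom layer of S^(j) amounts to a
   mutation of the initial y-variables at vertex 1.  The ideals with a given
   trace on the remaining elements form a Boolean interval, so both sums can be
   computed fibrewise, and counting the layers shows
     Sigma_{j+1}(w) = (1 + w_1)^e Sigma_j(mutated w),
   e being the number of representations of j by c and d.  Iterating,
   Sigma_j is a product of powers of the factors 1 + Y_s, where Y_s is the
   mutated y-variable at step s.  The recursion for e and the Y-system then
   give the recurrence satisfied by the F-polynomials, whose coefficients are
   monomials because the c-vectors at the mutated vertices are nonnegative. *)

Require Import Defs.
From mathcomp Require Import all_boot all_order all_algebra.
From mathcomp Require Import finmap fraction.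
From mathcomp Require Import zify ring.
From mathcomp.multinomials Require Import mpoly.

Set Implicit Arguments.
Unset Strict Implicit.
Unset Printing Implicit Defensive.

Import Order.TTheory GRing.Theory Num.Theory.
Local Open Scope fset_scope.
Local Open Scope ring_scope.

(** * Sums over order ideals *)

(** Write Sigma_m for the ideal sum and r(m) for the number of representations of m by c and d. The
    factorisation by itself only yields Sigma_m Sigma_{m-N} = (1 + Y_m) Sigma_{m-c} Sigma_{m-d}. It
    becomes an exchange relation once Y_m = q_m Sigma_{m-a} Sigma_{m-b} / (Sigma_{m-c} Sigma_{m-d})
    is known, q_m being the product of the y_k^{r(m-k)}. The Y_m satisfy a Y-system and the q_m its
    tropical version, in which every 1 + Y is replaced by 1; comparing the two gives the formula by
    induction on m. Since c is neither a nor b, the incoming and the outgoing arrows at the mutated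
    vertex involve distinct vertices. Hence each mutation merely shifts the labels of the quiver,
    and all exchange relations have the same shape. Divisions take place in a fraction field and are
    justified by positivity at y = 1. Values at x = 1 then pass through each exchange relation
    because the polynomials found there are nonzero. *)

Lemma order_idealsP (P I : {fset quad}) :
  reflect (I `<=` P /\ forall u v, u \in P -> v \in I -> quad_le u v -> u \in I)
          (I \in order_ideals P).
Proof.
rewrite !inE fpowersetE /=; apply: (iffP andP) => -[IP H]; split=> //.
  move=> u v uP vI uv; move/forallP: H => /(_ [` uP])/forallP.
  by move=> /(_ [` fsubsetP IP _ vI]) /=; rewrite vI uv.
apply/forallP => u; apply/forallP => v; apply/implyP => /andP[vI uv].
exact: H uv.
Qed.

Lemma order_filtersP (P R : {fset quad}) :
  reflect (R `<=` P /\ forall u v, u \in R -> v \in P -> quad_le u v -> v \in R)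
          (R \in order_filters P).
Proof.
rewrite !inE fpowersetE /=; apply: (iffP andP) => -[RP H]; split=> //.
  move=> u v uR vP uv; move/forallP: H => /(_ [` fsubsetP RP _ uR])/forallP.
  by move=> /(_ [` vP]) /=; rewrite uR uv.
apply/forallP => u; apply/forallP => v; apply/implyP => /andP[uR uv].
exact: H uv.
Qed.

Lemma quad_le_trans : transitive quad_le.
Proof.
move=> [[[? ?] ?] ?] [[[? ?] ?] ?] [[[? ?] ?] ?] /=.
by move=> /and4P[? ? ? ?] /and4P[? ? ? ?]; apply/and4P; split; lia.
Qed.

Lemma sum_fpowerset_exp (T : choiceType) (R : comPzRingType) (w : R) (V : {fset T}) :
  \sum_(X <- fpowerset V) w ^+ #|` X| = (1 + w) ^+ #|` V|.
Proof.
elim/fset1U_rect: V => [|x V xV IH].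
  by rewrite fpowerset0 big_seq_fset1 cardfs0 !expr0.
have xX X : X \in fpowerset V -> x \notin X.
  by rewrite fpowersetE => /fsubsetP XV; apply: contra xV => /XV.
rewrite cardfsU1 xV exprD expr1 mulrDl mul1r -IH.
rewrite (perm_big (fpowerset V ++ [seq x |` X | X <- fpowerset V])) /=.
  rewrite big_cat big_map /= mulr_sumr; congr (_ + _).
  apply: eq_big_seq => X XV; by rewrite cardfsU1 xX // exprD expr1.
apply: uniq_perm; first exact: fset_uniq.
  rewrite cat_uniq fset_uniq map_inj_in_uniq ?fset_uniq ?andbT /=.
    apply/hasPn => _ /mapP[X XV ->]; apply/negP => /xX.
    by rewrite fset1U1.
  move=> X Y /xX nX /xX nY /(congr1 (fun Z => Z `\ x)).
  by rewrite !fsetU1K.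
move=> X; rewrite fpowersetE mem_cat fpowersetE.
apply/idP/orP => [XV|[XV|/mapP[Y]]].
- have [xX'|xX'] := boolP (x \in X).
    right; apply/mapP; exists (X `\ x); rewrite ?fsetD1K //.
    by rewrite fpowersetE fsubDset.
  left; apply/fsubsetP => y yX; move/fsubsetP: XV => /(_ y yX).
  by rewrite in_fset1U => /orP[/eqP yx|//]; rewrite -yx yX in xX'.
- exact: fsubset_trans XV (fsubsetU1 _ _).
by rewrite fpowersetE => YV ->; apply: fsetUS.
Qed.

(* If C separates the comparable elements of D, the ideals of C `|` D that meet
   C in K are obtained by adding any set between forced K and allowed K. *)
Section Extension.
Variables C D : {fset quad}.
Implicit Types K X I : {fset quad}.

Definition forced K : {fset quad} := [fset x in D | has (quad_le x) K].
Definition allowed K : {fset quad} :=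
  [fset x in D | all (fun y => quad_le y x ==> (y \in K)) C].

Lemma forcedP K x :
  reflect (x \in D /\ exists2 y, y \in K & quad_le x y) (x \in forced K).
Proof.
rewrite !inE /=; apply: (iffP andP) => -[xD H]; split=> //; exact/hasP.
Qed.

Lemma allowedP K x :
  reflect (x \in D /\ forall y, y \in C -> quad_le y x -> y \in K) (x \in allowed K).
Proof.
rewrite !inE /=; apply: (iffP andP) => -[xD H]; split=> //.
  by move=> y yC; apply/implyP; move/allP: H; apply.
by apply/allP => y yC; apply/implyP; apply: H.
Qed.

Lemma forced_allowed K : K \in order_ideals C -> forced K `<=` allowed K.
Proof.
move=> /order_idealsP[_ KC]; apply/fsubsetP => x /forcedP[xD [y yK xy]].
apply/allowedP; split=> // z zC zx; apply: KC yK _ => //; exact: quad_le_trans xy.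
Qed.

Hypothesis CD : [disjoint C & D].
Hypothesis interpolation : forall x y, x \in D -> y \in D -> quad_le x y ->
  x != y -> exists2 z, z \in C & quad_le x z && quad_le z y.

Let notinD x : x \in C -> x \notin D.
Proof. by move=> xC; move/fdisjointP: CD; apply. Qed.

Let mem_free K X : X \in fpowerset (allowed K `\` forced K) -> X `<=` allowed K.
Proof. by rewrite fpowersetE => /fsubset_trans; apply; apply: fsubsetDl. Qed.

Lemma extension_ideal K X : K \in order_ideals C ->
  X \in fpowerset (allowed K `\` forced K) ->
  K `|` (forced K `|` X) \in order_ideals (C `|` D).
Proof.
move=> KI XI; have fa := forced_allowed KI; have /order_idealsP[KC Kd] := KI.
have Xa := mem_free XI.
have fXa x : x \in forced K `|` X -> x \in allowed K.
  by rewrite in_fsetU => /orP[/(fsubsetP fa)|/(fsubsetP Xa)].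
apply/order_idealsP; split.
  by apply: fsetUSS => //; apply/fsubsetP => x /fXa /allowedP[].
move=> u v; rewrite in_fsetU => uCD; rewrite in_fsetU.
have fu y : u \in D -> y \in K -> quad_le u y -> u \in K `|` (forced K `|` X).
  move=> uD yK uy; rewrite !in_fsetU; apply/or3P; apply: Or32; apply/forcedP.
  by split=> //; exists y.
case/orP => [vK|vX] uv.
  case/orP: uCD => [uC|uD]; last exact: fu uv.
  by rewrite in_fsetU (Kd u v).
have [vD vK] := allowedP _ _ (fXa _ vX).
case/orP: uCD => [uC|uD]; first by rewrite in_fsetU vK.
have [->|uv'] := eqVneq u v; first by rewrite in_fsetU vX orbT.
(* A comparison inside [D] passes through an element of [C], and [v] being allowed puts that element
   in [K]. *)
have [z zC /andP[uz zv]] := interpolation uD vD uv uv'.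
exact: fu (vK _ zC zv) uz.
Qed.

Lemma extension_restrict K X : K `<=` C -> X `<=` D -> (K `|` X) `&` C = K.
Proof.
move=> KC XD; apply/fsetP => x; rewrite in_fsetI in_fsetU.
have [xC|xC] := boolP (x \in C); last first.
  by rewrite andbF; apply/esym/negbTE; apply: contra xC => /(fsubsetP KC).
rewrite andbT orb_idr // => /(fsubsetP XD) xD.
by have := notinD xC; rewrite xD.
Qed.

Lemma ideal_extension I : I \in order_ideals (C `|` D) ->
  let K := I `&` C in
  [/\ K \in order_ideals C, forced K `<=` I `&` D
    & (I `&` D) `\` forced K \in fpowerset (allowed K `\` forced K)].
Proof.
move=> /order_idealsP[ICD Id] K; split.
- apply/order_idealsP; split; first exact: fsubsetIr.
  move=> u v uC; rewrite !in_fsetI uC andbT => /andP[vI _].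
  by apply: Id => //; rewrite in_fsetU uC.
- apply/fsubsetP => x /forcedP[xD [y]]; rewrite !in_fsetI => /andP[yI _] xy.
  by rewrite xD andbT; apply: Id yI xy; rewrite in_fsetU xD orbT.
rewrite fpowersetE; apply: fsetSD; apply/fsubsetP => x; rewrite in_fsetI => /andP[xI xD].
apply/allowedP; split=> // y yC yx; rewrite in_fsetI yC andbT.
by apply: Id xI yx; rewrite in_fsetU yC.
Qed.

(** An ideal is determined by its trace [K] on [C] and by its elements in [D] that [K] does not
    force. By interpolation the latter form an arbitrary subset of the allowed unforced elements. *)
Lemma sum_order_ideals_extension (R : comPzRingType) (f : {fset quad} -> R) :
  \sum_(I <- order_ideals (C `|` D)) f I =
  \sum_(K <- order_ideals C)
     \sum_(X <- fpowerset (allowed K `\` forced K)) f (K `|` (forced K `|` X)).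
Proof.
rewrite -(big_allpairs_dep (h := fun K X => K `|` (forced K `|` X))
  (r2 := fun K => fpowerset (allowed K `\` forced K) : seq _)).
have inD K X : K \in order_ideals C -> X \in fpowerset (allowed K `\` forced K) ->
    forced K `|` X `<=` D.
  move=> KI XI; apply/fsubsetP => x; rewrite in_fsetU => /orP[/forcedP[]//|].
  by move/(fsubsetP (mem_free XI)) => /allowedP[].
apply: perm_big; apply: uniq_perm; first exact: fset_uniq.
  apply: allpairs_uniq_dep => [||[K X] [K' X'] /allpairsPdep /=].
  - exact: fset_uniq.
  - by move=> K _; apply: fset_uniq.
  move=> [K1 [X1 [KI XI [? ?]]]]; subst K1 X1.
  move=> /allpairsPdep /= [K1 [X1 [KI' XI' [? ?]]]]; subst K1 X1 => e.
  have /order_idealsP[KC _] := KI; have /order_idealsP[KC' _] := KI'.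
  have eK : K = K'.
    rewrite -(extension_restrict KC (inD _ _ KI XI)) e.
    exact: extension_restrict KC' (inD _ _ KI' XI').
  subst K'; suff sub Y Y' : Y \in fpowerset (allowed K `\` forced K) ->
      K `|` (forced K `|` Y) = K `|` (forced K `|` Y') -> Y `<=` Y'.
    by suff -> : X = X' by []; apply/eqP; rewrite eqEfsubset !sub.
  move=> YI e'; apply/fsubsetP => x xY; move: (YI); rewrite fpowersetE.
  move=> /fsubsetP /(_ x xY); rewrite in_fsetD => /andP[/negbTE xf /allowedP[xD _]].
  have /negbTE xK : x \notin K by apply: contraL xD => /(fsubsetP KC) /notinD.
  have := congr1 (fun S : {fset quad} => x \in S) e'.
  by rewrite /= !in_fsetU xK xf xY /= => <-.
move=> I; apply/idP/allpairsPdep => [II|[K [X [KI XI ->]]]]; last exact: extension_ideal.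
have [KI fI XI] := ideal_extension II; exists (I `&` C), ((I `&` D) `\` forced (I `&` C)).
split=> //; have /order_idealsP[ICD _] := II.
apply/fsetP => x; have := fsubsetP ICD x; have := fsubsetP fI x.
rewrite !(in_fsetU, in_fsetI, in_fsetD).
case: (x \in I) (x \in C) (x \in D) (x \in forced _) => [] [] [] [] //= h1 h2.
all: by first [move: (h1 isT) | move: (h2 isT)].
Qed.

Lemma sum_order_ideals_prod (R : comPzRingType) (g : quad -> R) (w : R) :
  (forall l, l \in D -> g l = w) ->
  \sum_(I <- order_ideals (C `|` D)) \prod_(l <- I) g l =
  \sum_(K <- order_ideals C) (\prod_(l <- K) g l) *
     (w ^+ #|` forced K| * (1 + w) ^+ (#|` allowed K| - #|` forced K|)).
Proof.
move=> gw; rewrite sum_order_ideals_extension; apply: eq_big_seq => K KI.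
have fa := forced_allowed KI; have /order_idealsP[KC _] := KI.
rewrite -cardfsDS // -sum_fpowerset_exp !mulr_sumr; apply: eq_big_seq => X XI.
have Xa := mem_free XI.
have fD x : x \in forced K `|` X -> x \in D.
  by rewrite in_fsetU => /orP[/forcedP[]//|/(fsubsetP Xa)/allowedP[]].
rewrite -exprD; have -> : (#|` forced K| + #|` X| = #|` forced K `|` X|)%N.
  rewrite -cardfsUI; suff -> : forced K `&` X = fset0 by rewrite cardfs0 addn0.
  apply/eqP/fset0Pn => -[x]; rewrite in_fsetI => /andP[xf].
  by move: XI; rewrite fpowersetE => /fsubsetP XI /XI; rewrite in_fsetD xf.
rewrite (perm_big (enum_fset K ++ enum_fset (forced K `|` X))) /=.
  rewrite big_cat /=; congr (_ * _).
  rewrite (eq_big_seq (fun=> w)) => [|x /fD /gw //].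
  by rewrite big_const_seq count_predT iter_mulr_1.
apply: uniq_perm; first exact: fset_uniq.
  rewrite cat_uniq !fset_uniq andbT /=; apply/hasPn => x /fD.
  by apply: contraL => /(fsubsetP KC)/notinD.
by move=> x; rewrite mem_cat in_fsetU.
Qed.

End Extension.

(** * The posets S^(j) and S^(j+1) *)

Lemma card_fset_bij (T T' : choiceType) (A : {fset T}) (B : {fset T'})
    (f : T -> T') (g : T' -> T) :
  (forall x, x \in A -> f x \in B /\ g (f x) = x) ->
  (forall y, y \in B -> g y \in A /\ f (g y) = y) -> #|` A| = #|` B|.
Proof.
move=> fA gB; rewrite -(size_map f A).
apply: perm_size; apply: uniq_perm.
- rewrite map_inj_in_uniq ?fset_uniq // => x y /fA[_ xK] /fA[_ yK] e.
  by rewrite -xK e yK.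
- exact: fset_uniq.
move=> y; apply/mapP/idP => [[x /fA[fx _] ->] //|/gB[gy gK]].
by exists (g y); rewrite ?gK.
Qed.

Lemma sum_indicator (T : choiceType) (K : {fset T}) (P : pred T) :
  (\sum_(x <- K) P x)%N = #|` [fset x in K | P x]|.
Proof.
rewrite -big_mkcond sum1_count -size_filter; apply: perm_size; apply: uniq_perm.
- exact: filter_uniq.
- exact: fset_uniq.
by move=> x; rewrite mem_filter !inE andbC.
Qed.

Definition shift (v l : quad) : quad :=
  let: (v1, v2, v3, v4) := v in let: (l1, l2, l3, l4) := l in
  (l1 + v1, l2 + v2, l3 + v3, l4 + v4).

Section Slabs.
Variables a b c d N : nat.
Hypotheses (a0 : (0 < a)%N) (b0 : (0 < b)%N) (c0 : (0 < c)%N) (d0 : (0 < d)%N).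
Hypotheses (abN : (a + b = N)%N) (cdN : (c + d = N)%N).
Variable j : nat.
Local Notation wt := (weight a b c d).

(* S^(j+1) is core_slab together with top_slab, S^(j) is core_slab together with
   bottom_slab, and the labels agree on core_slab up to a shift by one. *)
Definition core_slab := gr_poset N.-1 a b c d j.
Definition top_slab := gr_poset 1 a b c d j.+1.
Definition bottom_slab := gr_poset 1 a b c d (j.+1 - N)%N.

Local Notation C := core_slab.
Local Notation T := top_slab.
Local Notation B := bottom_slab.

Definition top_face : {fset quad} :=
  [fset l in T | (l.1.1.1 == 0) && (l.1.1.2 == 0)].

Let quadrant (l : quad) : bool :=
  [&& 0 <= l.1.1.1, 0 <= l.1.1.2, l.1.2 <= 0 & l.2 <= 0].

Let inC l : (l \in C) = (j%:Z - N%:Z < wt l < j%:Z) && quadrant l.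
Proof. by case: l => [[[? ?] ?] ?]; rewrite in_gr_poset //= /quadrant /=; lia. Qed.

Let inT l : (l \in T) = (wt l == j%:Z) && quadrant l.
Proof. by case: l => [[[? ?] ?] ?]; rewrite in_gr_poset //= /quadrant /=; lia. Qed.

Let wt_ge0 l : quadrant l -> 0 <= wt l.
Proof. by case: l => [[[? ?] ?] ?]; rewrite /quadrant /= => H; nia. Qed.

Let inB l : (l \in B) = (wt l == j%:Z - N%:Z) && quadrant l.
Proof.
have := @wt_ge0 l.
case: l => [[[? ?] ?] ?]; rewrite in_gr_poset //= /quadrant /=.
(* The subtraction in [bottom_slab] is truncated; for [j < N] both sides are empty because weights
   on the quadrant are nonnegative. *)
by case: (leqP N j.+1) => ?; lia.
Qed.

Let in_top_face l : (l \in top_face) = (l \in T) && ((l.1.1.1 == 0) && (l.1.1.2 == 0)).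
Proof. by rewrite !inE. Qed.

Lemma gr_poset_top : gr_poset N a b c d j.+1 = C `|` T.
Proof.
apply/fsetP => l; rewrite in_fsetU inC inT.
by case: l => [[[? ?] ?] ?]; rewrite in_gr_poset // /quadrant /=; lia.
Qed.

Lemma gr_poset_bottom : gr_poset N a b c d j = C `|` B.
Proof.
apply/fsetP => l; rewrite in_fsetU inC inB.
by case: l => [[[? ?] ?] ?]; rewrite in_gr_poset // /quadrant /=; lia.
Qed.

Lemma disjoint_core_top : [disjoint C & T].
Proof. by apply/fdisjointP => l; rewrite inC inT; lia. Qed.

Lemma disjoint_core_bottom : [disjoint C & B].
Proof. by apply/fdisjointP => l; rewrite inC inB; lia. Qed.

(** Since [c] and [d] are positive, distinct comparable elements of equal weight differ in one of
    the first two coordinates. Lowering that coordinate of [y] by one lowers the weight by [a] or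
    [b], which is less than [N], and so lands in the core. *)
Lemma top_interpolation x y : x \in T -> y \in T -> quad_le x y -> x != y ->
  exists2 z, z \in C & quad_le x z && quad_le z y.
Proof.
rewrite !inT; case: x => [[[x1 x2] x3] x4]; case: y => [[[y1 y2] y3] y4].
rewrite /quadrant !xpair_eqE /= => xT yT xy nxy.
have [lt1|le1] := ltP x1 y1.
  by exists (y1 - 1, y2, y3, y4); rewrite ?inC /quadrant /=; lia.
have [lt2|le2] := ltP x2 y2.
  by exists (y1, y2 - 1, y3, y4); rewrite ?inC /quadrant /=; lia.
have e1 : x1 = y1 by lia.
have e2 : x2 = y2 by lia.
subst; have h3 : 0 <= c%:Z * (y3 - x3) by apply: mulr_ge0; lia.
have h4 : 0 <= d%:Z * (y4 - x4) by apply: mulr_ge0; lia.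
have : c%:Z * (y3 - x3) = 0 /\ d%:Z * (y4 - x4) = 0 by split; lia.
by case=> /eqP; rewrite mulf_eq0 => k3 /eqP; rewrite mulf_eq0 => k4; lia.
Qed.

Lemma bottom_interpolation x y : x \in B -> y \in B -> quad_le x y -> x != y ->
  exists2 z, z \in C & quad_le x z && quad_le z y.
Proof.
rewrite !inB; case: x => [[[x1 x2] x3] x4]; case: y => [[[y1 y2] y3] y4].
rewrite /quadrant !xpair_eqE /= => xT yT xy nxy.
have [lt1|le1] := ltP x1 y1.
  by exists (x1 + 1, x2, x3, x4); rewrite ?inC /quadrant /=; lia.
have [lt2|le2] := ltP x2 y2.
  by exists (x1, x2 + 1, x3, x4); rewrite ?inC /quadrant /=; lia.
have e1 : x1 = y1 by lia.
have e2 : x2 = y2 by lia.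
subst; have h3 : 0 <= c%:Z * (y3 - x3) by apply: mulr_ge0; lia.
have h4 : 0 <= d%:Z * (y4 - x4) by apply: mulr_ge0; lia.
have : c%:Z * (y3 - x3) = 0 /\ d%:Z * (y4 - x4) = 0 by split; lia.
by case=> /eqP; rewrite mulf_eq0 => k3 /eqP; rewrite mulf_eq0 => k4; lia.
Qed.

(** * Forced and allowed elements counted by layers of an ideal of the core *)

Section Counting.
Variable K : {fset quad}.
Hypothesis KI : K \in order_ideals C.

Let layer (m : nat) : {fset quad} := [fset l in K | j%:Z - wt l == m%:Z].
Let face (v : quad) : {fset quad} := [fset l in T | shift v l \in K].

Let KC l : l \in K -> l \in C.
Proof. by case/order_idealsP: KI => /fsubsetP KC _; apply: KC. Qed.

Let Kdown u v : u \in C -> v \in K -> quad_le u v -> u \in K.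
Proof. by case/order_idealsP: KI => _; apply. Qed.

Local Notation e1 := (1, 0, 0, 0).
Local Notation e2 := (0, 1, 0, 0).
Local Notation e3 := (0, 0, 1, 0).
Local Notation e4 := (0, 0, 0, 1).

Let inface v l : (l \in face v) = (l \in T) && (shift v l \in K).
Proof. by rewrite !inE. Qed.

Let inlayer m l : (l \in layer m) = (l \in K) && (j%:Z - wt l == m%:Z).
Proof. by rewrite !inE. Qed.

Let card_face (m : nat) v v' :
  (forall l, wt (shift v l) = wt l - m%:Z) ->
  (forall l, l \in K -> wt l = j%:Z - m%:Z -> quadrant (shift v' l)) ->
  cancel (shift v) (shift v') -> cancel (shift v') (shift v) ->
  #|` face v| = #|` layer m|.
Proof.
move=> wv qv vK v'K; apply: (@card_fset_bij _ _ _ _ (shift v) (shift v')) => l.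
  rewrite inface inlayer inT => /andP[/andP[/eqP lw _] ->]; rewrite vK wv lw /=.
  by split=> //; apply/eqP; lia.
rewrite inface inlayer inT => /andP[lK /eqP wl]; rewrite v'K lK.
have := wv (shift v' l); rewrite v'K => wl'.
by split=> //; rewrite andbT qv //; [rewrite andbT; apply/eqP|]; lia.
Qed.

Let shiftK v v' : shift v v' = (0, 0, 0, 0) -> cancel (shift v) (shift v').
Proof.
case: v v' => [[[? ?] ?] ?] [[[? ?] ?] ?] [? ? ? ?] [[[? ?] ?] ?] /=.
by congr (_, _, _, _); lia.
Qed.

Let card_face1 : #|` face (-1, 0, 0, 0)| = #|` layer a|.
Proof.
apply: (card_face (v' := e1)); try exact: shiftK.
  by case=> [[[? ?] ?] ?] /=; lia.
by move=> [[[? ?] ?] ?] /KC; rewrite inC /quadrant /=; lia.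
Qed.

Let card_face2 : #|` face (0, -1, 0, 0)| = #|` layer b|.
Proof.
apply: (card_face (v' := e2)); try exact: shiftK.
  by case=> [[[? ?] ?] ?] /=; lia.
by move=> [[[? ?] ?] ?] /KC; rewrite inC /quadrant /=; lia.
Qed.

Let card_face3 : #|` face e3| = #|` layer c|.
Proof.
apply: (card_face (v' := (0, 0, -1, 0))); try exact: shiftK.
  by case=> [[[? ?] ?] ?] /=; lia.
by move=> [[[? ?] ?] ?] /KC; rewrite inC /quadrant /=; lia.
Qed.

Let card_face4 : #|` face e4| = #|` layer d|.
Proof.
apply: (card_face (v' := (0, 0, 0, -1))); try exact: shiftK.
  by case=> [[[? ?] ?] ?] /=; lia.
by move=> [[[? ?] ?] ?] /KC; rewrite inC /quadrant /=; lia.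
Qed.

Let forced_top : forced T K = face e3 `|` face e4.
Proof.
apply/fsetP => l; rewrite in_fsetU !inface -andb_orr.
apply/forcedP/andP => -[lT H]; split=> //.
  case: H => y yK; have := KC yK; move: y l yK lT => [[[y1 y2] y3] y4] [[[l1 l2] l3] l4].
  rewrite inT inC /quadrant /= => yK lT yC ly; apply/orP.
  have [lt3|le3] := ltP l3 y3.
    by left; apply: Kdown yK _; rewrite ?inC /quadrant /=; lia.
  have [lt4|le4] := ltP l4 y4.
    by right; apply: Kdown yK _; rewrite ?inC /quadrant /=; lia.
  (* Otherwise [y] exceeds [l] only in the first two coordinates, which makes its weight at least
     [j]. *)
  nia.
by case/orP: H => H; [exists (shift e3 l)|exists (shift e4 l)] => //;
  case: l {lT H} => [[[l1 l2] l3] l4] /=; lia.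
Qed.

(** Translation by (0, 0, -1, -1) raises the weight by [c + d = N], so it carries the bottom layer
    to the top one. The two maximal core elements below [l] become the neighbours of the translate
    in the directions [e4] and [e3]. *)
Let card_allowed_bottom : #|` allowed C B K| = #|` face e3 `&` face e4|.
Proof.
apply: (@card_fset_bij _ _ _ _ (shift (0, 0, -1, -1)) (shift (0, 0, 1, 1))) => l; last first.
  rewrite in_fsetI !inface => /andP[/andP[lT l3] /andP[_ l4]].
  have := KC l3; have := KC l4; move: l lT l3 l4 => [[[l1 l2] l3] l4].
  rewrite inT !inC /quadrant /= => lT K3 K4 C4 C3; split; last first.
    by congr (_, _, _, _); lia.
  apply/allowedP; split; first by rewrite inB /quadrant /=; lia.
  move=> [[[y1 y2] y3] y4] yC; have := yC; rewrite inC /quadrant /= => yC' yl.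
  have [lt3|le3] := ltP y3 (l3 + 1).
    by apply: Kdown K4 _ => //=; lia.
  have [lt4|le4] := ltP y4 (l4 + 1).
    by apply: Kdown K3 _ => //=; lia.
  nia.
case/allowedP; case: l => [[[l1 l2] l3] l4]; rewrite inB /quadrant /= => lB lC.
rewrite in_fsetI !inface !inT /quadrant /=; split; last by congr (_, _, _, _); lia.
apply/andP; split; apply/andP; split; try lia.
all: by apply: lC; rewrite ?inC /quadrant /=; lia.
Qed.

(** Inclusion-exclusion for two faces: their union is forced in the top layer, their intersection
    corresponds to what is allowed in the bottom layer, and each face is a translated layer of
    [K]. *)
Lemma card_forced_top :
  (#|` forced T K| + #|` allowed C B K| = #|` layer c| + #|` layer d|)%N.
Proof. by rewrite forced_top card_allowed_bottom cardfsUI card_face3 card_face4. Qed.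

(* forced B K, translated by (1, 1, 0, 0) into the top slab. *)
Let M : {fset quad} := [fset l in T | shift (-1, -1, 0, 0) l \in forced B K].

Let inM0 l : (l \in M) = (l \in T) && (shift (-1, -1, 0, 0) l \in forced B K).
Proof. by rewrite !inE. Qed.

Let card_M : #|` M| = #|` forced B K|.
Proof.
apply: (@card_fset_bij _ _ _ _ (shift (-1, -1, 0, 0)) (shift (1, 1, 0, 0))) => l.
  rewrite inM0 => /andP[_ ->]; split=> //.
  by case: l => [[[? ?] ?] ?] /=; congr (_, _, _, _); lia.
move=> lf; have [lB _] := forcedP _ _ _ lf; split; last first.
  by case: l {lf lB} => [[[? ?] ?] ?] /=; congr (_, _, _, _); lia.
rewrite inM0; apply/andP; split.
  by move: l lB {lf} => [[[? ?] ?] ?]; rewrite inB inT /quadrant /=; lia.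
by rewrite (shiftK _ _ (v := (1, 1, 0, 0))).
Qed.

Let inM l : (l \in M) = [&& l \in T, 0 < l.1.1.1, 0 < l.1.1.2 &
  (shift (-1, 0, 0, 0) l \in K) || (shift (0, -1, 0, 0) l \in K)].
Proof.
rewrite inM0; have [lT|//] := boolP (l \in T); rewrite /=.
apply/forcedP/and3P => [[lB [y yK]]|[p1 p2 H]].
  have := KC yK; move: y l yK lT lB => [[[y1 y2] y3] y4] [[[l1 l2] l3] l4].
  rewrite inT inB inC /quadrant /= => yK lT lB yC ly; split; try lia; apply/orP.
  have [lt1|le1] := ltP (l1 - 1) y1.
    by right; apply: Kdown yK _; rewrite ?inC /quadrant /=; lia.
  have [lt2|le2] := ltP (l2 - 1) y2.
    by left; apply: Kdown yK _; rewrite ?inC /quadrant /=; lia.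
  nia.
move: l lT p1 p2 H => [[[l1 l2] l3] l4]; rewrite inT inB /quadrant /= => lT p1 p2 H.
split; first by lia.
by case/orP: H => H; [exists (l1 + -1, l2 + 0, l3 + 0, l4 + 0)
  |exists (l1 + 0, l2 + -1, l3 + 0, l4 + 0)] => //=; lia.
Qed.

Let in_allowed_top l : (l \in allowed C T K) =
  [&& l \in T, (0 < l.1.1.1) ==> (shift (-1, 0, 0, 0) l \in K)
    & (0 < l.1.1.2) ==> (shift (0, -1, 0, 0) l \in K)].
Proof.
apply/allowedP/and3P => [[lT lC]|[lT H1 H2]]; split=> //.
- apply/implyP => l0; apply: lC; case: l lT l0 => [[[l1 l2] l3] l4];
    by rewrite inT ?inC /quadrant /=; lia.
- apply/implyP => l0; apply: lC; case: l lT l0 => [[[l1 l2] l3] l4];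
    by rewrite inT ?inC /quadrant /=; lia.
move=> y yC; move: y l yC lT H1 H2 => [[[y1 y2] y3] y4] [[[l1 l2] l3] l4] yC.
have := yC; rewrite inC inT /quadrant /= => yC' lT /implyP H1 /implyP H2 yl.
have [lt1|le1] := ltP y1 l1.
  by apply: Kdown (H1 _) _ => //=; lia.
have [lt2|le2] := ltP y2 l2.
  by apply: Kdown (H2 _) _ => //=; lia.
nia.
Qed.

(** On [top_face] being allowed is an empty condition. The remaining allowed elements and [M] have
    the same union and intersection as the two faces obtained by lowering a first or second
    coordinate: where both coordinates are positive, being allowed asks for both lower neighbours
    and [M] for at least one; where only one is positive, [M] is absent and a single face is
    involved. *)
Lemma card_allowed_top : (#|` allowed C T K| + #|` forced B K|
  = #|` top_face| + (#|` layer a| + #|` layer b|))%N.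
Proof.
rewrite -card_M -card_face1 -card_face2.
rewrite -(cardfsID top_face (allowed C T K)) -addnA; congr (_ + _)%N.
  congr #|` _|; apply/fsetP => l; rewrite in_fsetI in_allowed_top in_top_face /=.
  by case: (l \in T) => //=; rewrite andb_idl // => /andP[/eqP -> /eqP ->].
have pos l : l \in T -> [&& 0 <= l.1.1.1, 0 <= l.1.1.2,
    (shift (-1, 0, 0, 0) l \in K) ==> (0 < l.1.1.1)
    & (shift (0, -1, 0, 0) l \in K) ==> (0 < l.1.1.2)].
  rewrite inT => /andP[_]; have := @KC (shift (-1, 0, 0, 0) l).
  have := @KC (shift (0, -1, 0, 0) l); case: l => [[[l1 l2] l3] l4].
  rewrite !inC /quadrant /= => h1 h2 q.
  by apply/and4P; split; try lia; apply/implyP => [/h2|/h1]; lia.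
rewrite -[LHS]cardfsUI -[RHS]cardfsUI; congr (_ + _)%N; congr #|` _|; apply/fsetP => l.
  rewrite !in_fsetU in_fsetD in_top_face inM in_allowed_top !inface.
  have [lT|nT] := boolP (l \in T); rewrite /= ?andbF //=.
  move: (pos l lT).
  by case: (shift (-1, 0, 0, 0) l \in K) (shift (0, -1, 0, 0) l \in K) => [] [] /=; lia.
rewrite !in_fsetI in_fsetD in_top_face inM in_allowed_top !inface.
have [lT|nT] := boolP (l \in T); rewrite /= ?andbF //=.
move: (pos l lT).
by case: (shift (-1, 0, 0, 0) l \in K) (shift (0, -1, 0, 0) l \in K) => [] [] /=; lia.
Qed.

End Counting.
End Slabs.

(** Here [f], [u] count the forced and allowed elements of the top layer, [f'], [u'] those of the
    bottom layer, and [p], [q] the elements of the ideal whose weights mutation changes. The two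
    linear relations are what makes the exponents of [x] and [1 + x] agree. *)
Lemma layer_exponents (K : fieldType) (x P : K) (f u f' u' e p q : nat) :
  x != 0 -> 1 + x != 0 -> (f <= u)%N -> (f' <= u')%N ->
  (f + u' = q)%N -> (u + f' = e + p)%N ->
  P * (x ^+ f * (1 + x) ^+ (u - f)) =
  (1 + x) ^+ e * (P * (1 + x) ^+ p * (x / (1 + x)) ^+ q
                  * (x^-1 ^+ f' * (1 + x^-1) ^+ (u' - f'))).
Proof.
move=> x0 x1 /subnKC <- /subnKC <- <-; rewrite ![(_ + _ - _)%N]addKn.
move: (u - f)%N (u' - f')%N => s t ep.
have -> : 1 + x^-1 = (1 + x) / x by field.
transitivity (P * (1 + x) ^+ (e + p) * (x / (1 + x)) ^+ (f + (f' + t))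
              * (x^-1 ^+ f' * ((1 + x) / x) ^+ t)); last by rewrite exprD; ring.
rewrite -ep !exprMn !exprVn !exprD.
have := expf_neq0 f x0; have := expf_neq0 f' x0; have := expf_neq0 t x0.
have := expf_neq0 f x1; have := expf_neq0 f' x1; have := expf_neq0 t x1.
move: (x ^+ f) (x ^+ f') (x ^+ t) ((1 + x) ^+ f) ((1 + x) ^+ f') ((1 + x) ^+ t).
move: ((1 + x) ^+ s) => *; field.
by do !(apply/andP; split).
Qed.

(** * Ideal sums under one mutation of the weights *)

Section IdealSums.
Variables (K : fieldType) (a b c d N : nat).
Hypotheses (a0 : (0 < a)%N) (b0 : (0 < b)%N) (c0 : (0 < c)%N) (d0 : (0 < d)%N).
Hypotheses (abN : (a + b = N)%N) (cdN : (c + d = N)%N).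
Implicit Types w : int -> K.
Local Notation wt := (weight a b c d).

Definition ideal_sum (j : nat) w : K :=
  \sum_(I <- order_ideals (gr_poset N a b c d j)) \prod_(l <- I) w (j%:Z - wt l).

(* Mutation of the y-variables at the first vertex of the window, followed by
   the shift that puts the mutated vertex last. *)
Definition mutate_shift w (k : int) : K :=
  if k == N%:Z then (w 1)^-1 else
  w (k + 1) * (1 + w 1) ^+ ((k == a%:Z) + (k == b%:Z))
            * (w 1 / (1 + w 1)) ^+ ((k == c%:Z) + (k == d%:Z)).

Lemma prod_layers (x : K) (S : {fset quad}) (j p q : nat) :
  \prod_(l <- S) x ^+ ((j%:Z - wt l == p%:Z) + (j%:Z - wt l == q%:Z))
  = x ^+ (#|` [fset l in S | j%:Z - wt l == p%:Z]| + #|` [fset l in S | j%:Z - wt l == q%:Z]|).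
Proof.
by rewrite prodrXr; congr (_ ^+ _); rewrite big_split /= !sum_indicator.
Qed.

Lemma ideal_sum_step j w : w 1 != 0 -> 1 + w 1 != 0 ->
  ideal_sum j.+1 w
  = (1 + w 1) ^+ #|` top_face a b c d j| * ideal_sum j (mutate_shift w).
Proof.
move=> w0 w1; rewrite /ideal_sum.
rewrite (gr_poset_top a0 b0 c0 d0 abN cdN) (gr_poset_bottom a0 b0 c0 d0 abN cdN).
set C := core_slab _ _ _ _ _ _; set T := top_slab _ _ _ _ _; set B := bottom_slab _ _ _ _ _ _.
have CI l : l \in C -> j%:Z - N%:Z < wt l < j%:Z.
  by case: l => [[[? ?] ?] ?]; rewrite in_gr_poset //=; lia.
rewrite (@sum_order_ideals_prod C T _ _ _ _ (w 1)); last first.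
- by case=> [[[? ?] ?] ?]; rewrite in_gr_poset //= => ?; congr w; lia.
- exact: top_interpolation.
- exact: disjoint_core_top.
rewrite (@sum_order_ideals_prod C B _ _ _ _ (w 1)^-1); last first.
- move=> l lB; rewrite /mutate_shift; suff -> : j%:Z - wt l = N%:Z by rewrite eqxx.
  move: l lB => [[[? ?] ?] ?]; rewrite in_gr_poset //=.
  by case: (leqP N j.+1) => ?; nia.
- exact: bottom_interpolation.
- exact: disjoint_core_bottom.
rewrite mulr_sumr; apply: eq_big_seq => S SI.
have fT := fsubset_leq_card (forced_allowed T SI).
have fB := fsubset_leq_card (forced_allowed B SI).
have := card_allowed_top a0 b0 c0 d0 abN cdN SI.
have := card_forced_top a0 b0 c0 d0 abN cdN SI.
rewrite -/C -/T -/B => eq1 eq2.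
have -> : \prod_(l <- S) mutate_shift w (j%:Z - wt l) =
    \prod_(l <- S) w (j.+1%:Z - wt l)
    * (1 + w 1) ^+ (#|` [fset l in S | j%:Z - wt l == a%:Z]| + #|` [fset l in S | j%:Z - wt l == b%:Z]|)
    * (w 1 / (1 + w 1)) ^+ (#|` [fset l in S | j%:Z - wt l == c%:Z]| + #|` [fset l in S | j%:Z - wt l == d%:Z]|).
  rewrite -!prod_layers -!big_split /=; apply: eq_big_seq => l lS.
  have {}lS : l \in C by case/order_idealsP: SI => /fsubsetP SC _; apply: SC.
  have lN := CI l lS; rewrite /mutate_shift ifF; last by lia.
  by congr (w _ * _ * _); lia.
exact: layer_exponents.
Qed.

End IdealSums.

(** * The Y-system and the recurrence for the ideal sums *)

Section Faces.
Variables a b c d N : nat.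
Hypotheses (a0 : (0 < a)%N) (b0 : (0 < b)%N) (c0 : (0 < c)%N) (d0 : (0 < d)%N).

(* In bijection with the representations of m as a sum of c's and d's. *)
Definition face_int (m : int) : {fset quad} :=
  [fset l in top_face a b c d `|m|%N | weight a b c d l == m].

Lemma in_face_int m l : (l \in face_int m) =
  [&& l.1.1.1 == 0, l.1.1.2 == 0, l.1.2 <= 0, l.2 <= 0 & - c%:Z * l.1.2 - d%:Z * l.2 == m].
Proof.
have -> : (l \in face_int m) = (l \in gr_poset 1 a b c d `|m|.+1)
    && ((l.1.1.1 == 0) && (l.1.1.2 == 0)) && (weight a b c d l == m) by rewrite !inE.
case: l => [[[l1 l2] l3] l4]; rewrite in_gr_poset //=.
by apply/idP/idP => H; nia.
Qed.

Lemma face_int_nat (m : nat) : face_int m%:Z = top_face a b c d m.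
Proof.
apply/fsetP => l; rewrite in_face_int.
have -> : (l \in top_face a b c d m) = (l \in gr_poset 1 a b c d m.+1)
    && ((l.1.1.1 == 0) && (l.1.1.2 == 0)) by rewrite !inE.
case: l => [[[l1 l2] l3] l4]; rewrite in_gr_poset //=.
by apply/idP/idP => H; nia.
Qed.

Hypothesis cdN : (c + d = N)%N.

(** The generating function of these cardinals is 1 / ((1 - t^c)(1 - t^d)), and the denominator is 1
    - t^c - t^d + t^N. The proof is inclusion-exclusion on the representations that use [c] and
    those that use [d]; only the empty representation of 0 uses neither. *)
Lemma card_face_int_rec (m : int) :
  (#|` face_int m| + #|` face_int (m - N%:Z)| =
   (m == 0) + (#|` face_int (m - c%:Z)| + #|` face_int (m - d%:Z)|))%N.
Proof.
pose A := [fset l in face_int m | l.1.2 < 0].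
pose B := [fset l in face_int m | l.2 < 0].
have inA l : (l \in A) = (l \in face_int m) && (l.1.2 < 0) by rewrite !inE.
have inB l : (l \in B) = (l \in face_int m) && (l.2 < 0) by rewrite !inE.
have -> : #|` face_int (m - c%:Z)| = #|` A|.
  apply: (card_fset_bij (f := shift (0, 0, -1, 0)) (g := shift (0, 0, 1, 0))) => -[[[l1 l2] l3] l4].
    by rewrite inA !in_face_int /=; split; [|congr (_, _, _, _)]; lia.
  by rewrite inA !in_face_int /=; split; [|congr (_, _, _, _)]; lia.
have -> : #|` face_int (m - d%:Z)| = #|` B|.
  apply: (card_fset_bij (f := shift (0, 0, 0, -1)) (g := shift (0, 0, 0, 1))) => -[[[l1 l2] l3] l4].
    by rewrite inB !in_face_int /=; split; [|congr (_, _, _, _)]; lia.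
  by rewrite inB !in_face_int /=; split; [|congr (_, _, _, _)]; lia.
have -> : #|` face_int (m - N%:Z)| = #|` A `&` B|.
  apply: (card_fset_bij (f := shift (0, 0, -1, -1)) (g := shift (0, 0, 1, 1))) => -[[[l1 l2] l3] l4].
    by rewrite in_fsetI inA inB !in_face_int /=; split; [|congr (_, _, _, _)]; lia.
  by rewrite in_fsetI inA inB !in_face_int /=; split; [|congr (_, _, _, _)]; lia.
rewrite -(cardfsUI A B) addnA; congr (_ + _)%N.
have -> : face_int m = (if m == 0 then [fset (0, 0, 0, 0) : quad] else fset0) `|` (A `|` B).
  apply/fsetP => -[[[l1 l2] l3] l4]; rewrite !in_fsetU inA inB in_face_int /=.
  have [->|m0] := eqVneq m 0; rewrite !inE ?xpair_eqE /=.
    by apply/idP/idP => H; nia.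
  by apply/idP/idP => H; nia.
have [m0|//] := eqVneq m 0; last by rewrite fset0U.
rewrite cardfsU1 in_fsetU inA inB /= !ltxx !andbF //.
Qed.

End Faces.

(** The algebra of the induction step in [ystep_ideal_sum]: [sa] stands for the sum at [m - a],
    [saN] at [m - a - N], [sac] at [m - a - c], and likewise for the others. The term [sN] arises
    from both [m - c - d] and [m - d - c]. *)
Lemma y_system_cancel (K : fieldType)
    (y e qm qN qc qd sa sb sc sd saN sbN scN sdN sN scc sdd sac sad sbc sbd : K) :
  qN != 0 -> saN != 0 -> sbN != 0 -> scN != 0 -> sdN != 0 -> sN != 0 ->
  scc != 0 -> sdd != 0 -> sac != 0 -> sad != 0 -> sbc != 0 -> sbd != 0 ->
  qm * qN = e * (qc * qd) ->
  y * (qN * (saN * sbN) / (scN * sdN)) *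
    (sc * scN / (scc * sN) * (sd * sdN / (sN * sdd))) =
  e * (sa * saN / (sac * sad) * (sb * sbN / (sbc * sbd))) *
    (qc * (sac * sbc) / (scc * sN) * (qd * (sad * sbd) / (sN * sdd))) ->
  y * (sc * sd) = qm * (sa * sb).
Proof.
move=> qN0 saN0 sbN0 scN0 sdN0 sN0 scc0 sdd0 sac0 sad0 sbc0 sbd0 qE yE.
have X0 : qN * (saN * sbN) / (scc * sN * sN * sdd) != 0.
  by rewrite !mulf_neq0 ?invr_neq0 ?mulf_neq0.
apply: (mulIf X0).
transitivity (y * (qN * (saN * sbN) / (scN * sdN)) *
    (sc * scN / (scc * sN) * (sd * sdN / (sN * sdd)))).
  by field; rewrite sdN0 scN0 sdd0 sN0 scc0.
rewrite yE; transitivity (qm * qN * (sa * sb) * (saN * sbN / (scc * sN * sN * sdd))).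
  by rewrite qE; field; rewrite sdd0 sN0 scc0 sbd0 sbc0 sad0 sac0.
by ring.
Qed.

Section YSystem.
Variables (K : fieldType) (pos : K -> Prop) (a b c d N : nat).
Hypotheses (a0 : (0 < a)%N) (b0 : (0 < b)%N) (c0 : (0 < c)%N) (d0 : (0 < d)%N).
Hypotheses (abN : (a + b = N)%N) (cdN : (c + d = N)%N).
Hypotheses (pos1 : pos 1) (pos_neq0 : forall x, pos x -> x != 0).
Hypothesis posD : forall x y, pos x -> pos y -> pos (x + y).
Hypothesis posM : forall x y, pos x -> pos y -> pos (x * y).
Hypothesis posV : forall x, pos x -> pos x^-1.
Variable w : int -> K.
Hypothesis pos_w : forall k, pos (w k).

Local Notation mut := (mutate_shift a b c d N).
Local Notation wt := (weight a b c d).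

Let posX x n : pos x -> pos (x ^+ n).
Proof. by move=> px; elim: n => [|n IH]; rewrite ?expr0 // exprS; apply: posM. Qed.

Lemma pos_mutate_shift (v : int -> K) : (forall k, pos (v k)) -> forall k, pos (mut v k).
Proof.
move=> pv k; rewrite /mutate_shift; case: ifP => _; first exact: posV.
have p1 := posD pos1 (pv 1).
by apply: posM; [apply: posM|]; rewrite ?exprMn //; do ?apply: posX => //;
  apply: posM; apply: posX => //; apply: posV.
Qed.

Definition yhat (s : nat) : int -> K := iter s mut w.

Let pos_yhat s k : pos (yhat s k).
Proof. by elim: s k => [|s IH] k //=; apply: pos_mutate_shift. Qed.

(* For m <= 0, where there is no mutation, both ystep and ystep1 are 1; there
   ystep1 is not 1 + ystep. *)
Definition ystep (m : int) : K := if 0 < m then yhat `|m - 1|%N 1 else 1.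
Definition ystep1 (m : int) : K := if 0 < m then 1 + ystep m else 1.

Lemma pos_ystep m : pos (ystep m).
Proof. by rewrite /ystep; case: ifP. Qed.

Lemma pos_ystep1 m : pos (ystep1 m).
Proof. by rewrite /ystep1; case: ifP => // _; apply: posD => //; apply: pos_ystep. Qed.

Definition ideal_sum_int (j : int) : K :=
  if j is Posz k then ideal_sum a b c d N k w else 1.
Local Notation S := ideal_sum_int.

Lemma ideal_sum0 (v : int -> K) : ideal_sum a b c d N 0 v = 1.
Proof.
rewrite /ideal_sum; have -> : gr_poset N a b c d 0 = fset0.
  by apply/fsetP => -[[[? ?] ?] ?]; rewrite in_gr_poset // in_fset0; nia.
rewrite (perm_big [:: fset0]); first by rewrite big_seq1 big_seq_fset0.
apply: uniq_perm => //; first exact: fset_uniq.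
move=> I; rewrite mem_seq1; apply/order_idealsP/eqP => [[I0 _]|->].
  by apply/eqP; rewrite -fsubset0.
by split.
Qed.

Lemma ideal_sum_iter j s : ideal_sum a b c d N j (yhat s) =
  \prod_(i < j) ystep1 (s + i).+1%:Z ^+ #|` top_face a b c d (j.-1 - i)|.
Proof.
elim: j s => [|j IH] s; first by rewrite big_ord0 ideal_sum0.
have y0 : ystep1 s.+1%:Z = 1 + yhat s 1.
  by rewrite /ystep1 /ystep /=; congr (1 + yhat _ _); lia.
rewrite ideal_sum_step //; last first.
- by apply: pos_neq0; apply: posD.
- exact: pos_neq0.
rewrite -/(yhat s.+1) -[mut _]/(yhat s.+1) IH big_ord_recl /= addn0 y0 subn0; congr (_ * _).
apply: eq_bigr => i _; rewrite /bump /= add1n addnS addSn; congr (_ ^+ #|` top_face _ _ _ _ _|).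
by lia.
Qed.

(** Letting all [j <= J] share one range of factors allows products for different [j] to be compared
    factor by factor. The added exponents vanish, as negative integers have no representation. *)
Lemma ideal_sum_intE (J : nat) (j : int) : j <= J%:Z ->
  S j = \prod_(i < J) ystep1 i.+1%:Z ^+ #|` face_int a b c d (j - i.+1%:Z)|.
Proof.
have neg m : m < 0 -> #|` face_int a b c d m| = 0%N.
  move=> m0; apply/eqP; rewrite cardfs_eq0; apply/eqP/fsetP => l.
  by rewrite in_face_int // in_fset0; apply/negP; nia.
case: j => [j|j] jJ /=; last first.
  by rewrite big1 // => i _; rewrite neg ?expr0 //; lia.
rewrite (ideal_sum_iter j 0) (big_ord_widen_cond J xpredT
  (fun i => ystep1 (0 + i).+1%:Z ^+ #|` top_face a b c d (j.-1 - i)|)); last by lia.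
rewrite big_mkcond /=; apply: eq_bigr => i _; rewrite add0n.
case: ltnP => ij; last by rewrite neg ?expr0 //; lia.
by rewrite -face_int_nat //; congr (_ ^+ #|` face_int _ _ _ _ _|); lia.
Qed.

(** By the recursion for representations the exponents on both sides differ only at the factor of
    index [m], by one. *)
Lemma ideal_sum_int_exchange m :
  S m * S (m - N%:Z) = ystep1 m * (S (m - c%:Z) * S (m - d%:Z)).
Proof.
have [m0|m0] := leP m 0.
  by rewrite !(@ideal_sum_intE 0) ?big_ord0 ?/ystep1 ?ltNge ?m0 ?mulr1 //; lia.
have [k mk] : exists k : nat, m = k.+1%:Z by exists `|m - 1|%N; lia.
rewrite !(@ideal_sum_intE k.+1) ?mk; try lia.
transitivity (\prod_(i < k.+1) ystep1 i.+1%:Z ^+ (k == i) *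
  (\prod_(i < k.+1) ystep1 i.+1%:Z ^+ #|` face_int a b c d (k.+1%:Z - c%:Z - i.+1%:Z)| *
  \prod_(i < k.+1) ystep1 i.+1%:Z ^+ #|` face_int a b c d (k.+1%:Z - d%:Z - i.+1%:Z)|)).
  rewrite -!big_split /=; apply: eq_bigr => i _; rewrite -!exprD; congr (_ ^+ _).
  have := card_face_int_rec a0 b0 c0 d0 cdN (k.+1%:Z - i.+1%:Z).
  rewrite !(addrAC _ (- i.+1%:Z)) => ->; congr (nat_of_bool _ + _)%N; lia.
congr (_ * _); rewrite big_ord_recr /= eqxx expr1 big1 ?mul1r // => i _.
by rewrite (_ : (k == i) = false) ?expr0 //; have := ltn_ord i; lia.
Qed.

Lemma pos_ideal_sum_int m : pos (S m).
Proof.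
rewrite (@ideal_sum_intE `|m|%N); last by lia.
elim/big_ind: _ => // i _; exact/posX/pos_ystep1.
Qed.

Definition ycoef (p : int) : K := if (0 < p) && (p <= N%:Z) then w p else 1.

(* Position p of the window after s steps has received the factors coming from
   the mutations at p - a, p - b, p - c and p - d, as far as they are past. *)
Lemma yhatE (s : nat) (k : int) : 0 < k <= N%:Z ->
  let p := s%:Z + k in
  let upto (f : int -> K) q := if q <= s%:Z then f q else 1 in
  yhat s k * ystep (p - N%:Z) * (upto ystep1 (p - c%:Z) * upto ystep1 (p - d%:Z)) =
  ycoef p * (upto ystep1 (p - a%:Z) * upto ystep1 (p - b%:Z))
          * (upto ystep (p - c%:Z) * upto ystep (p - d%:Z)).
Proof.
elim: s k => [|s IH] k kN.
  rewrite /= !add0r.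
  have h q : (if q <= 0 then ystep1 q else 1) = 1.
    by rewrite /ystep1; case: (leP q 0).
  have h' q : (if q <= 0 then ystep q else 1) = 1.
    by rewrite /ystep; case: (leP q 0).
  rewrite !h !h' !mulr1 /ystep ifF ?mulr1; last by lia.
  by rewrite /ycoef kN.
have ys : ystep s.+1%:Z = yhat s 1.
  by rewrite /ystep /=; congr (yhat _ _); lia.
have ys1 : ystep1 s.+1%:Z = 1 + yhat s 1 by rewrite /ystep1 ys.
have n0 := pos_neq0 (pos_yhat s 1).
have n1 : 1 + yhat s 1 != 0 by apply: pos_neq0; apply: posD.
rewrite [yhat s.+1 k]/= -/(yhat s) /mutate_shift.
have [kE|kE] := eqVneq k N%:Z.
  have -> : s.+1%:Z + k - N%:Z = s.+1%:Z by lia.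
  rewrite ys mulVf // /ycoef ifF; last by lia.
  by rewrite !ifF ?mulr1 //; lia.
have /IH : 0 < k + 1 <= N%:Z by lia.
have -> : s%:Z + (k + 1) = s.+1%:Z + k by lia.
have upS (f : int -> K) (q : nat) : let p := s.+1%:Z + k - q%:Z in
    (if p <= s.+1%:Z then f p else 1) =
    (if p <= s%:Z then f p else 1) * f s.+1%:Z ^+ (k == q%:Z).
  rewrite /=; have [->|kq] := eqVneq k q%:Z.
    rewrite addrK lexx expr1 ifF ?mul1r //; lia.
  rewrite expr0 mulr1; case: ifP => h1; case: ifP => h2 //; lia.
rewrite /= !upS ys ys1 => IHk.
rewrite !exprD !exprMn !exprVn.
have := expf_neq0 (k == c%:Z) n1; have := expf_neq0 (k == d%:Z) n1.
move: ((1 + yhat s 1) ^+ (k == a%:Z)) ((1 + yhat s 1) ^+ (k == b%:Z)) => pa pb.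
move: ((1 + yhat s 1) ^+ (k == c%:Z)) ((1 + yhat s 1) ^+ (k == d%:Z)) => pc pd pd0 pc0.
move: (yhat s 1 ^+ (k == c%:Z)) (yhat s 1 ^+ (k == d%:Z)) => yc yd.
transitivity (yhat s (k + 1) * ystep (s.+1%:Z + k - N%:Z) *
    ((if s.+1%:Z + k - c%:Z <= s%:Z then ystep1 (s.+1%:Z + k - c%:Z) else 1) *
     (if s.+1%:Z + k - d%:Z <= s%:Z then ystep1 (s.+1%:Z + k - d%:Z) else 1))
    * (pa * pb * (yc * yd))); first by field; rewrite pc0 pd0.
rewrite IHk; by do 4!move: (if _ then _ else _) => ?; ring.
Qed.

Lemma y_system m : ystep m * ystep (m - N%:Z) * (ystep1 (m - c%:Z) * ystep1 (m - d%:Z)) =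
  ycoef m * (ystep1 (m - a%:Z) * ystep1 (m - b%:Z)) * (ystep (m - c%:Z) * ystep (m - d%:Z)).
Proof.
have [m0|m0] := leP m 0.
  by rewrite /ycoef /ystep1 /ystep !ifF ?mulr1 //; lia.
have [s ms] : exists s : nat, m = s%:Z + 1 by exists `|m - 1|%N; lia.
(* Position 1 is the one about to be mutated: all the mutations that affect it are past, so every
   truncated factor is present. *)
have /(yhatE s) : 0 < (1 : int) <= N%:Z by lia.
rewrite -ms /= !ifT; try lia.
by rewrite (_ : yhat s 1 = ystep m) // /ystep m0; congr (yhat _ _); lia.
Qed.

(** The tropical counterpart of [ystep]: its recursion is [y_system] with all values of [ystep1]
    replaced by 1. *)
Variable q : int -> K.
Hypotheses (q_neq0 : forall m, q m != 0) (q_le0 : forall m, m <= 0 -> q m = 1).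
Hypothesis q_rec : forall m,
  q m * q (m - N%:Z) = ycoef m * (q (m - c%:Z) * q (m - d%:Z)).

(** This is the separation of a Y-variable into its tropical part and a ratio of F-polynomials. In
    the Y-system at [m], [ideal_sum_int_exchange] removes [ystep1] and induction removes the earlier
    values of [ystep], which leaves [ystep m] as the only unknown. *)
Lemma ystep_ideal_sum m :
  ystep m * (S (m - c%:Z) * S (m - d%:Z)) = q m * (S (m - a%:Z) * S (m - b%:Z)).
Proof.
have [k] := ubnP `|m|%N; elim: k m => // k IH m mk.
have [m0|m0] := leP m 0.
  rewrite !(@ideal_sum_intE 0) ?big_ord0; try lia.
  by rewrite q_le0 // /ystep ltNge m0.
(* A negative [m - e] may exceed [m] in absolute value, so nonpositive indices are settled
   directly. *)
have {}IH (e : nat) : (0 < e)%N -> let p := m - e%:Z in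
  ystep p * (S (p - c%:Z) * S (p - d%:Z)) = q p * (S (p - a%:Z) * S (p - b%:Z)).
  move=> e0 p; have [p0|p0] := leP p 0; last by apply: IH; lia.
  rewrite !(@ideal_sum_intE 0) ?big_ord0; try lia.
  by rewrite q_le0 // /ystep ltNge p0.
have S0 p : S p != 0 by apply/pos_neq0/pos_ideal_sum_int.
have A0 p : ystep p != 0 by apply/pos_neq0/pos_ystep.
have H0 p : ystep1 p != 0 by apply/pos_neq0/pos_ystep1.
have N0 : (0 < N)%N by lia.
have HE p : ystep1 p = S p * S (p - N%:Z) / (S (p - c%:Z) * S (p - d%:Z)).
  by rewrite ideal_sum_int_exchange mulfK // mulf_neq0.
have AE e : (0 < e)%N -> let p := m - e%:Z in
    ystep p = q p * (S (p - a%:Z) * S (p - b%:Z)) / (S (p - c%:Z) * S (p - d%:Z)).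
  by move=> e0 p; rewrite -IH // mulfK // mulf_neq0.
have := y_system m; rewrite !HE (AE N) // (AE c) // (AE d) //.
have dc : m - d%:Z - c%:Z = m - N%:Z by lia.
have cd : m - c%:Z - d%:Z = m - N%:Z by lia.
rewrite !(addrAC m (- N%:Z)) !(addrAC m _ (- a%:Z)) !(addrAC m _ (- b%:Z)) dc cd.
by apply: y_system_cancel; rewrite ?q_rec.
Qed.

Lemma ideal_sum_int_rec m : 0 < m ->
  S m * S (m - N%:Z) =
  q m * (S (m - a%:Z) * S (m - b%:Z)) + S (m - c%:Z) * S (m - d%:Z).
Proof.
move=> m0; rewrite ideal_sum_int_exchange -ystep_ideal_sum /ystep1 m0.
by ring.
Qed.

End YSystem.

(** * Periodicity of the Gale-Robinson quiver *)

Section QuiverShift.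
Variables a b c d N : nat.
Hypotheses (a0 : (0 < a)%N) (b0 : (0 < b)%N) (c0 : (0 < c)%N) (d0 : (0 < d)%N).
Hypotheses (abN : (a + b = N)%N) (cdN : (c + d = N)%N).
Hypothesis cab : c \notin [:: a; b].

Definition corner (p q : nat) (i j : int) : bool :=
  [&& j == i + p%:Z - q%:Z, N%:Z < i + p%:Z & i - q%:Z < 1].

Definition arrows (i j : int) : nat :=
  ((j == i + a%:Z)%R + (j == i + b%:Z)%R + (j == i - c%:Z)%R + (j == i - d%:Z)%R
   + corner a c i j + corner a d i j + corner b c i j + corner b d i j)%N.

Definition exchange (i j : int) : int := (arrows j i)%:Z - (arrows i j)%:Z.

Lemma exchangeC i j : exchange j i = - exchange i j.
Proof. by rewrite /exchange opprB. Qed.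

Let aN : (a < N)%N. Proof. lia. Qed.
Let bN : (b < N)%N. Proof. lia. Qed.
Let cN : (c < N)%N. Proof. lia. Qed.
Let dN : (d < N)%N. Proof. lia. Qed.

Let corner1l p q j : (p < N)%N -> corner p q 1 j = false.
Proof. by move=> pN; rewrite /corner; lia. Qed.

Let corner1r p q i : (p < N)%N -> (q < N)%N -> corner p q i 1 = false.
Proof. by move=> pN qN; rewrite /corner; lia. Qed.

Let cornerNl p q j : (q < N)%N -> corner p q N%:Z j = false.
Proof. by move=> qN; rewrite /corner; lia. Qed.

Let cornerNr p q i : (p < N)%N -> (q < N)%N -> corner p q i N%:Z = false.
Proof. by move=> pN qN; rewrite /corner; lia. Qed.

Lemma exchange_col1 i : 1 <= i <= N%:Z -> exchange i 1 =
  ((i == 1 + a%:Z)%R + (i == 1 + b%:Z)%R)%N%:Z - ((i == 1 + c%:Z)%R + (i == 1 + d%:Z)%R)%N%:Z.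
Proof.
move=> iN; have pos1 (p : nat) : (0 < p)%N -> (1 == i + p%:Z) = false by lia.
have neg1 (p : nat) : (0 < p)%N -> (i == 1 - p%:Z) = false by lia.
have sub1 (p : nat) : (1 == i - p%:Z) = (i == 1 + p%:Z) by lia.
rewrite /exchange /arrows !corner1l ?corner1r ?neg1 ?pos1 ?sub1 ?addn0 ?add0n //.
Qed.

Lemma exchange_colN i : 1 <= i <= N%:Z -> exchange i N%:Z =
  ((i == c%:Z) + (i == d%:Z))%N%:Z - ((i == a%:Z) + (i == b%:Z))%N%:Z.
Proof.
move=> iN; have posN (p : nat) : (0 < p)%N -> (i == N%:Z + p%:Z) = false by lia.
have negN (p : nat) : (0 < p)%N -> (N%:Z == i - p%:Z) = false by lia.
have addN p q : (p + q = N)%N -> (N%:Z == i + p%:Z) = (i == q%:Z) by lia.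
have subN p q : (p + q = N)%N -> (i == N%:Z - p%:Z) = (i == q%:Z) by lia.
have [baN dcN] : (b + a = N)%N /\ (d + c = N)%N by lia.
rewrite /exchange /arrows !cornerNl ?cornerNr ?negN ?posN ?addn0 ?add0n //.
rewrite (addN a b) // (addN b a) // (subN c d) // (subN d c) //.
by congr (Posz _ - Posz _); rewrite addnC.
Qed.

(** The arrows counted by [corner p q] start at the [i] with [p' < i <= q]. After the shift the
    range is [p' <= i < q], so when [p' < q] only its two ends change; otherwise both ranges are
    empty. *)
Let corner_diff p p' q q' i j : (p + p' = N)%N -> (q + q' = N)%N ->
  (corner p q i j)%:Z = (corner p q (i + 1) (j + 1))%:Z +
  (p' < q)%N%:Z * (((i == q%:Z) && (j == p%:Z))%:Z - ((i == p'%:Z) && (j == q'%:Z))%:Z).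
Proof. by move=> pN qN; rewrite /corner; case: ltnP => ?; lia. Qed.

(** The two products are the correction terms of a mutation at vertex 1: mutating and then lowering
    the labels by one restores the matrix. *)
Lemma exchange_shift i j : exchange i j = exchange (i + 1) (j + 1)
  + (((i == a%:Z)%R + (i == b%:Z)%R) * ((j == c%:Z)%R + (j == d%:Z)%R))%N%:Z
  - (((i == c%:Z)%R + (i == d%:Z)%R) * ((j == a%:Z)%R + (j == b%:Z)%R))%N%:Z.
Proof.
have [baN dcN] : (b + a = N)%N /\ (d + c = N)%N by lia.
have E k l (p : nat) : (k + 1 == l + 1 + p%:Z) = (k == l + p%:Z) by lia.
have E' k l (p : nat) : (k + 1 == l + 1 - p%:Z) = (k == l - p%:Z) by lia.
(* [b < c] means [d < a], which is the negation of [a < d] because [c != b] forces [a != d]; the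
   next line uses [c != a] in the same way. *)
have lt1 : (b < c)%N%:Z = 1 - (a < d)%N%:Z by move: cab; rewrite !inE; lia.
have lt2 : (b < d)%N%:Z = 1 - (a < c)%N%:Z by move: cab; rewrite !inE; lia.
rewrite !(mulnDl, mulnDr) !mulnb /exchange /arrows !E !E' !PoszD.
rewrite !(corner_diff i j abN cdN) !(corner_diff j i abN cdN).
rewrite !(corner_diff i j abN dcN) !(corner_diff j i abN dcN).
rewrite !(corner_diff i j baN cdN) !(corner_diff j i baN cdN).
rewrite !(corner_diff i j baN dcN) !(corner_diff j i baN dcN).
rewrite lt1 lt2 !(andbC (j == _)).
by ring.
Qed.

End QuiverShift.

(** * Seeds along the mutation sequence *)

Lemma pos_part_nat (m : nat) : pos_part m%:Z = m.
Proof. by rewrite /pos_part; lia. Qed.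

Lemma pos_part_subn (m k : nat) : (m * k = 0)%N -> pos_part (m%:Z - k%:Z) = m.
Proof. by move=> /eqP; rewrite /pos_part muln_eq0; lia. Qed.

(** The exponents are added so as to include [u = v], which occurs for double arrows, when [a = b]
    or [c = d]. *)
Lemma prod_delta (R : comPzRingType) (I : finType) (f : I -> R) (u v : I) :
  \prod_i f i ^+ ((i == u) + (i == v)) = f u * f v.
Proof.
have one t : \prod_i f i ^+ (i == t) = f t.
  rewrite (bigD1 t) //= eqxx expr1 big1 ?mulr1 // => i it.
  by rewrite (negbTE it).
by rewrite -(one u) -(one v) -big_split /=; apply: eq_bigr => i _; rewrite exprD.
Qed.

(** * Vertices indexed by a sliding window of integers *)

Section Window.
Variables (N : nat) (v : int -> 'I_N).
Hypothesis v_inj : forall i j, 0 < j - i < N%:Z -> v i != v j.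

Lemma v_eq i j : - N%:Z < j - i < N%:Z -> (v i == v j) = (i == j).
Proof.
move=> ij; have [->|nij] := eqVneq i j; first by rewrite eqxx.
have [lij|lji] := ltP i j; first by apply/negbTE/v_inj; lia.
by rewrite eq_sym; apply/negbTE/v_inj; lia.
Qed.

Lemma v_surj (s : int) u : exists2 i : int, 1 <= i <= N%:Z & v (s + i) = u.
Proof.
have inj : injective (fun i : 'I_N => v (s + i.+1%:Z)).
  move=> i j /eqP; rewrite v_eq; last by have := ltn_ord i; have := ltn_ord j; lia.
  by move=> /eqP e; apply: val_inj => /=; lia.
have /codomP[i ->] : u \in codom (fun i : 'I_N => v (s + i.+1%:Z)) by rewrite injF_onto.
by exists i.+1%:Z => //; have := ltn_ord i; lia.
Qed.

Lemma v_bij : bijective (fun k : 'I_N => v k.+1%:Z).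
Proof.
apply: injF_bij => i j /eqP; rewrite v_eq; last first.
  by have := ltn_ord i; have := ltn_ord j; lia.
by move=> /eqP e; apply: val_inj => /=; lia.
Qed.

End Window.

Section SeedOrbit.
Variables (K : fieldType) (a b c d N p : nat).
Hypotheses (a0 : (0 < a)%N) (b0 : (0 < b)%N) (c0 : (0 < c)%N) (d0 : (0 < d)%N).
Hypotheses (abN : (a + b = N)%N) (cdN : (c + d = N)%N).
Hypothesis cab : c \notin [:: a; b].
(* v i is the vertex that is mutated at step i; after s steps the vertices are
   v (s + 1), ..., v (s + N), and their quiver is the initial one. *)
Variable v : int -> 'I_N.
Hypothesis v_period : forall i, v (i + N%:Z) = v i.
Hypothesis v_inj : forall i j, 0 < j - i < N%:Z -> v i != v j.
Variable s0 : seed K N p.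
Local Notation ex := (exchange a b c d N).
Hypothesis init_exchange : forall i j, 1 <= i <= N%:Z -> 1 <= j <= N%:Z ->
  exchange_matrix s0 (lshift p (v i)) (v j) = ex i j.

Definition orbit_seed (s : nat) : seed K N p :=
  foldl (@mutate K N p) s0 [seq v k%:Z | k <- iota 1 s].
Local Notation orb := orbit_seed.
Local Notation mat s := (exchange_matrix (orb s)).
Local Notation clu s := (extended_cluster (orb s) 0).

Lemma orbit_seedS s : orb s.+1 = mutate (orb s) (v s.+1%:Z).
Proof. by rewrite /orb -{1}[s.+1]addn1 iotaD map_cat foldl_cat /= add1n. Qed.

Definition ab_mark (i : int) : nat := ((i == a%:Z)%R + (i == b%:Z)%R)%N.
Definition cd_mark (i : int) : nat := ((i == c%:Z)%R + (i == d%:Z)%R)%N.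

(** No cancellation occurs in the first column, so its positive and negative parts are the marks
    themselves. *)
Lemma marks_disjoint i : (ab_mark i * cd_mark i = 0)%N.
Proof.
rewrite /ab_mark /cd_mark; move: cab; rewrite !inE negb_or => /andP[ca cb].
case: (eqVneq i a%:Z) => [->|ia]; first by rewrite [X in (_ * X)%N](_ : _ = 0%N) ?muln0 //; lia.
case: (eqVneq i b%:Z) => [->|ib]; first by rewrite [X in (_ * X)%N](_ : _ = 0%N) ?muln0 //; lia.
by rewrite mul0n.
Qed.

Lemma exchange_first i : 0 <= i < N%:Z -> ex (i + 1) 1 = (ab_mark i)%:Z - (cd_mark i)%:Z.
Proof.
move=> iN; rewrite exchange_col1 //; last by lia.
by rewrite ![i + 1]addrC !(can_eq (addKr 1)).
Qed.

Lemma orbit_matrix s i j : 1 <= i <= N%:Z -> 1 <= j <= N%:Z ->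
  mat s (lshift p (v (s%:Z + i))) (v (s%:Z + j)) = ex i j.
Proof.
elim: s i j => [|s IH] i j iN jN; first by rewrite !add0r init_exchange.
rewrite orbit_seedS mxE (inj_eq (@lshift_inj _ _)).
have vE k : v (s.+1%:Z + k) = v (s%:Z + (k + 1)) by congr v; lia.
have v1 : v s.+1%:Z = v (s%:Z + 1) by congr v; lia.
(* The mutated vertex leaves the window at the first place and re-enters at the last, with its signs
   reversed. *)
have vN : v (s.+1%:Z + N%:Z) = v (s%:Z + (0 + 1)) by rewrite v_period v1 add0r.
have vlast k : 1 <= k <= N%:Z -> (v (s.+1%:Z + k) == v s.+1%:Z) = (k == N%:Z).
  move=> kN; rewrite -(v_period s.+1%:Z) (v_eq v_inj); last by lia.
  by rewrite (can_eq (addKr _)).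
have mN k : 1 <= k <= N%:Z -> ex k N%:Z = (cd_mark k)%:Z - (ab_mark k)%:Z.
  by move=> kN; rewrite exchange_colN.
rewrite !vlast //; have [iE|iE] := eqVneq i N%:Z.
  rewrite iE vN /= exchangeC mN //.
  have [jE|jE] := eqVneq j N%:Z.
    rewrite jE vN IH; try lia.
    rewrite exchange_first; last lia.
    by rewrite /ab_mark /cd_mark; lia.
  rewrite vE IH ?add0r; try lia.
  by rewrite exchangeC exchange_first //; lia.
have [jE|jE] := eqVneq j N%:Z; rewrite /=.
  rewrite jE vN vE IH ?add0r; try lia.
  by rewrite mN // exchange_first; lia.
rewrite !vE v1 !IH; try lia.
rewrite [ex 1 (j + 1)]exchangeC !exchange_first; try lia.
rewrite !opprB !pos_part_subn ?marks_disjoint // ?(mulnC (cd_mark _)) ?marks_disjoint //.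
by rewrite [RHS]exchange_shift //; congr (_ - Posz _); apply: mulnC.
Qed.

Definition frozen_pos (s : nat) : K :=
  \prod_(k < p) clu s (rshift N k) ^+ pos_part (mat s (rshift N k) (v s.+1%:Z)).
Definition frozen_neg (s : nat) : K :=
  \prod_(k < p) clu s (rshift N k) ^+ pos_part (- mat s (rshift N k) (v s.+1%:Z)).

Lemma orbit_column s u :
  mat s (lshift p u) (v s.+1%:Z) =
  ((u == v (s.+1%:Z + a%:Z)) + (u == v (s.+1%:Z + b%:Z)))%N%:Z
  - ((u == v (s.+1%:Z + c%:Z)) + (u == v (s.+1%:Z + d%:Z)))%N%:Z.
Proof.
have [i iN <-] := (v_surj v_inj) s%:Z u.
have -> : v s.+1%:Z = v (s%:Z + 1) by congr v; lia.
rewrite orbit_matrix //; last by lia.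
have -> : i = i - 1 + 1 by lia.
rewrite exchange_first; last by lia.
by rewrite !(v_eq v_inj) /ab_mark /cd_mark; try congr (Posz (_ + _) - Posz (_ + _)); lia.
Qed.

Lemma orbit_new_variable s : let z := fun m : int => clu s (lshift p (v m)) in
  clu s.+1 (lshift p (v s.+1%:Z)) =
  (frozen_pos s * (z (s.+1%:Z + a%:Z) * z (s.+1%:Z + b%:Z))
   + frozen_neg s * (z (s.+1%:Z + c%:Z) * z (s.+1%:Z + d%:Z))) / z s.+1%:Z.
Proof.
move=> z; rewrite orbit_seedS mxE eqxx; congr (_ / _).
rewrite !big_split_ord /= -/(frozen_pos s) -/(frozen_neg s).
have dis u : (((u == v (s.+1%:Z + a%:Z)) + (u == v (s.+1%:Z + b%:Z))) *
    ((u == v (s.+1%:Z + c%:Z)) + (u == v (s.+1%:Z + d%:Z))) = 0)%N.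
  have [i iN <-] := (v_surj v_inj) s.+1%:Z u.
  rewrite !(v_eq v_inj) ?(can_eq (addKr _)); try lia.
  exact: marks_disjoint.
rewrite (eq_bigr (fun u => clu s (lshift p u) ^+
  ((u == v (s.+1%:Z + a%:Z)) + (u == v (s.+1%:Z + b%:Z))))); last first.
  by move=> u _; rewrite orbit_column pos_part_subn.
rewrite prod_delta mulrC; congr (_ * _ + _).
rewrite (eq_bigr (fun u => clu s (lshift p u) ^+
  ((u == v (s.+1%:Z + c%:Z)) + (u == v (s.+1%:Z + d%:Z))))); last first.
  by move=> u _; rewrite orbit_column opprB pos_part_subn // mulnC.
by rewrite prod_delta mulrC.
Qed.

Lemma orbit_old_variable s l : l != lshift p (v s.+1%:Z) -> clu s.+1 l = clu s l.
Proof. by move=> ls; rewrite orbit_seedS mxE (negbTE ls). Qed.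

(** Step [s] creates only the variable at position [m + N], so a property indexed by position needs
    checking on the initial window and along the exchange relation. It serves both the
    coefficient-free and the principal seed. *)
Lemma orbit_cluster_ind (P : int -> K -> Prop) :
  (forall i, 1 <= i <= N%:Z -> P i (extended_cluster s0 0 (lshift p (v i)))) ->
  (forall (s : nat) z za zb zc zd, let m := s.+1%:Z in
     P m z -> P (m + a%:Z) za -> P (m + b%:Z) zb -> P (m + c%:Z) zc ->
     P (m + d%:Z) zd ->
     P (m + N%:Z) ((frozen_pos s * (za * zb) + frozen_neg s * (zc * zd)) / z)) ->
  forall (s : nat) i, 1 <= i <= N%:Z ->
    P (s%:Z + i) (clu s (lshift p (v (s%:Z + i)))).
Proof.
move=> P0 PS; elim=> [|s IH] i iN; first by rewrite !add0r; apply: P0.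
have IH' m : s.+1%:Z <= m < s.+1%:Z + N%:Z -> P m (clu s (lshift p (v m))).
  move=> mN; have -> : m = s%:Z + (m - s%:Z) by lia.
  by apply: IH; lia.
have [->|iE] := eqVneq i N%:Z.
  rewrite v_period orbit_new_variable; apply: PS; apply: IH'; lia.
rewrite orbit_old_variable; first by apply: IH'; lia.
by rewrite (inj_eq (@lshift_inj _ _)) (v_eq v_inj); lia.
Qed.

End SeedOrbit.

(** * Evaluation at x_1 = ... = x_N = 1 *)

Section AtOnes.
Variables (R : idomainType) (n : nat).
Implicit Types (z w : ratfun R n) (u v : R).

Lemma at_ones_tofrac (P : {mpoly R[n]}) : at_ones (tofrac P) P.@[fun=> 1].
Proof. by exists P, 1; rewrite meval1 oner_neq0 tofrac1 !mulr1. Qed.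

Lemma at_onesM z w u v : at_ones z u -> at_ones w v -> at_ones (z * w) (u * v).
Proof.
move=> [P [Q [Q0 zQ uQ]]] [P' [Q' [Q'0 wQ vQ]]].
exists (P * P'), (Q * Q'); rewrite !mevalM -uQ -vQ !tofracM -zQ -wQ mulf_neq0 //.
by split=> //; ring.
Qed.

Lemma at_onesD z w u v : at_ones z u -> at_ones w v -> at_ones (z + w) (u + v).
Proof.
move=> [P [Q [Q0 zQ uQ]]] [P' [Q' [Q'0 wQ vQ]]].
exists (P * Q' + P' * Q), (Q * Q').
rewrite mevalD !mevalM -uQ -vQ tofracD !tofracM -zQ -wQ mulf_neq0 //.
by split=> //; ring.
Qed.

Lemma at_ones_neq0 z u : u != 0 -> at_ones z u -> z != 0.
Proof.
move=> u0 [P [Q [Q0 zQ uQ]]]; apply: contraNneq u0 => z0.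
move: zQ; rewrite z0 mul0r => /eqP; rewrite eq_sym tofrac_eq0 => /eqP P0.
by move/eqP: uQ; rewrite P0 meval0 mulf_eq0 (negbTE Q0) orbF.
Qed.

(** Values lie in a domain, so the quotient is supplied as a [t] with [t * v = u]; in the
    applications this equation comes from [F_poly_rec]. *)
Lemma at_ones_div z w u v t : v != 0 -> t * v = u ->
  at_ones z u -> at_ones w v -> at_ones (z / w) t.
Proof.
move=> v0 tv zu wv; have w0 := at_ones_neq0 v0 wv.
move: zu wv => [P [Q [Q0 zQ uQ]]] [P' [Q' [Q'0 wQ vQ]]].
exists (P * Q'), (Q * P'); rewrite !mevalM -uQ -vQ !tofracM -zQ -wQ -tv !mulf_neq0 //.
split=> //; last by ring.
by move: (tofrac Q) (tofrac Q') w0 => q q' w0; rewrite mulrACA [_^-1 * _]mulKf // mulrA.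
Qed.

End AtOnes.

(** * Fractions that are positive at ones *)

Section PositiveFractions.
Variable n : nat.

(** A class without zero that contains 1 and the variables and is closed under sum, product and
    inverse; hence no [1 + Y] arising from mutations vanishes. *)
Definition positive_fraction (z : ratfun int n) : Prop :=
  exists P Q : {mpoly int[n]},
    [/\ 0 < P.@[fun=> 1], 0 < Q.@[fun=> 1] & z * tofrac Q = tofrac P].

Lemma positive_fraction_neq0 z : positive_fraction z -> z != 0.
Proof.
move=> [P [Q [P0 Q0 zQ]]].
have QP : at_ones (tofrac P) P.@[fun=> 1] by apply: at_ones_tofrac.
have P0' : tofrac P != 0 by apply: at_ones_neq0 QP; rewrite gt_eqF.
by apply: contraNneq P0' => z0; rewrite -zQ z0 mul0r.
Qed.

Lemma positive_fraction1 : positive_fraction 1.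
Proof. by exists 1, 1; rewrite meval1 ltr01 mul1r. Qed.

Lemma positive_fractionX i : positive_fraction (tofrac 'X_i).
Proof. by exists 'X_i, 1; rewrite mevalXU meval1 ltr01 tofrac1 mulr1. Qed.

Lemma positive_fractionM z w :
  positive_fraction z -> positive_fraction w -> positive_fraction (z * w).
Proof.
move=> [P [Q [P0 Q0 zQ]]] [P' [Q' [P'0 Q'0 wQ']]].
exists (P * P'), (Q * Q'); rewrite !mevalM !mulr_gt0 //; split=> //.
by rewrite !tofracM -zQ -wQ'; ring.
Qed.

Lemma positive_fractionD z w :
  positive_fraction z -> positive_fraction w -> positive_fraction (z + w).
Proof.
move=> [P [Q [P0 Q0 zQ]]] [P' [Q' [P'0 Q'0 wQ']]].
exists (P * Q' + P' * Q), (Q * Q'); rewrite mevalD !mevalM addr_gt0 ?mulr_gt0 //.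
by split=> //; rewrite tofracD !tofracM -zQ -wQ'; ring.
Qed.

Lemma positive_fractionV z : positive_fraction z -> positive_fraction z^-1.
Proof.
move=> pz; have z0 := positive_fraction_neq0 pz.
by move: pz => [P [Q [P0 Q0 zQ]]]; exists Q, P; rewrite -zQ mulKf.
Qed.

End PositiveFractions.

(** * Principal coefficients *)

Section FrozenRows.
Variables (K : fieldType) (a b c d N : nat).
Hypotheses (a0 : (0 < a)%N) (b0 : (0 < b)%N) (c0 : (0 < c)%N) (d0 : (0 < d)%N).
Hypotheses (abN : (a + b = N)%N) (cdN : (c + d = N)%N).
Hypothesis cab : c \notin [:: a; b].
Variable v : int -> 'I_N.
Hypothesis v_period : forall i, v (i + N%:Z) = v i.
Hypothesis v_inj : forall i j, 0 < j - i < N%:Z -> v i != v j.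
Variable s0 : seed K N N.
Hypothesis init_exchange : forall i j, 1 <= i <= N%:Z -> 1 <= j <= N%:Z ->
  exchange_matrix s0 (lshift N (v i)) (v j) = exchange a b c d N i j.
Hypothesis init_frozen : forall u w, exchange_matrix s0 (rshift N u) w = (u == w)%:Z.

Local Notation mat s := (exchange_matrix (orbit_seed v s0 s)).
Local Notation r m := #|` face_int a b c d m|.

Let r_neg m : m < 0 -> r m = 0%N.
Proof.
move=> m0; apply/eqP; rewrite cardfs_eq0; apply/eqP/fsetP => l.
by rewrite in_face_int // in_fset0; apply/negP; nia.
Qed.

(* The c-vectors: at the next vertex to be mutated they are nonnegative, by the
   recursion for the cardinals of face_int. *)
Lemma orbit_frozen_matrix s k i : 1 <= k <= N%:Z -> 1 <= i <= N%:Z ->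
  let p := s%:Z + i in
  let upto (q : int) := if q <= s%:Z then (r (q - k))%:Z else 0 in
  mat s (rshift N (v k)) (v p) =
  (p == k)%:Z + upto (p - c%:Z) + upto (p - d%:Z) - (r (p - N%:Z - k))%:Z.
Proof.
have rec := card_face_int_rec a0 b0 c0 d0 cdN.
elim: s i => [|s IH] i kN iN.
  rewrite /= init_frozen !add0r (v_eq v_inj); last by lia.
  have up0 q : (if q <= 0%N%:Z then (r (q - k))%:Z else 0) = 0.
    by case: ifP => // q0; rewrite (r_neg (m := q - k)) //; lia.
  rewrite !up0 !addr0 (r_neg (m := i - N%:Z - k)) ?subr0 1?eq_sym //.
  by lia.
have first : mat s (rshift N (v k)) (v s.+1%:Z) = (r (s.+1%:Z - k))%:Z.
  have -> : s.+1%:Z = s%:Z + 1 by lia.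
  rewrite IH //; last by lia.
  rewrite !ifT; try lia.
  have := rec (s%:Z + 1 - k); rewrite !(addrAC _ (- k)) => e.
  by rewrite -(subr_eq0 _ k) -[X in X - _]addrA -!PoszD -e PoszD addrK.
move=> p upto; rewrite orbit_seedS mxE {}/p {}/upto.
rewrite (_ : (rshift N (v k) == lshift N _) = false); last first.
  by apply/eqP => /(congr1 val) /=; have := ltn_ord (v s.+1%:Z); lia.
have [->|iE] := eqVneq i N%:Z.
  rewrite v_period eqxx /= first.
  rewrite !ifF; try lia.
  rewrite !addr0 (_ : (s.+1%:Z + N%:Z == k) = false); last by lia.
  by rewrite sub0r; congr (- (#|` face_int _ _ _ _ _|%:Z)); lia.
have vi : (v (s.+1%:Z + i) == v s.+1%:Z) = false by rewrite (v_eq v_inj); lia.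
rewrite vi /= first.
have -> : s.+1%:Z + i = s%:Z + (i + 1) by lia.
rewrite IH //; last by lia.
have -> : v s.+1%:Z = v (s%:Z + 1) by congr v; lia.
rewrite (orbit_matrix a0 b0 c0 d0 abN cdN cab v_period v_inj init_exchange); try lia.
rewrite exchangeC (exchange_first a0 b0 c0 d0 abN cdN cab); last by lia.
have dis := marks_disjoint a0 b0 c0 d0 abN cdN cab i.
rewrite !opprB (pos_part_subn (m := cd_mark c d i)); last by rewrite mulnC.
(* As this c-vector entry is nonnegative, only the positive part of the mutated row contributes,
   namely [cd_mark c d i]. *)
have -> : pos_part (- (r (s.+1%:Z - k))%:Z) = 0%N by rewrite /pos_part; lia.
rewrite mul0n subr0 pos_part_nat.
have upS (q : nat) : let t := s%:Z + (i + 1) - q%:Z in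
    (if t <= s.+1%:Z then (r (t - k))%:Z else 0) =
    (if t <= s%:Z then (r (t - k))%:Z else 0) + (r (s.+1%:Z - k) * (i == q%:Z)%R)%N%:Z.
  rewrite /=; have [->|iq] := eqVneq i q%:Z.
    rewrite ifT; last by lia.
    rewrite ifF; last by lia.
    by rewrite muln1 add0r; congr (Posz #|` face_int _ _ _ _ _|); lia.
  by rewrite muln0 addr0; do 2![case: ifP => ?] => //; lia.
rewrite !upS /cd_mark mulnDr PoszD; ring.
Qed.

Lemma orbit_frozen_column s k : 1 <= k <= N%:Z ->
  mat s (rshift N (v k)) (v s.+1%:Z) = (r (s.+1%:Z - k))%:Z.
Proof.
move=> kN; have -> : s.+1%:Z = s%:Z + 1 by lia.
rewrite orbit_frozen_matrix //; last by lia.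
rewrite !ifT; try lia.
have := card_face_int_rec a0 b0 c0 d0 cdN (s%:Z + 1 - k).
rewrite !(addrAC _ (- k)) => e.
by rewrite -(subr_eq0 _ k) -[X in X - _]addrA -!PoszD -e PoszD addrK.
Qed.

Lemma orbit_frozen_cluster s k :
  extended_cluster (orbit_seed v s0 s) 0 (rshift N k) = extended_cluster s0 0 (rshift N k).
Proof.
elim: s => // s IH; rewrite orbit_old_variable //.
by apply/eqP => /(congr1 val) /=; have := ltn_ord (v s.+1%:Z); lia.
Qed.

Lemma frozen_posE s : frozen_pos v s0 s =
  \prod_(k < N) extended_cluster s0 0 (rshift N (v k.+1%:Z)) ^+ r (s.+1%:Z - k.+1%:Z).
Proof.
rewrite /frozen_pos (reindex (fun k : 'I_N => v k.+1%:Z)) /=; last exact: onW_bij (v_bij v_inj).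
apply: eq_bigr => k _; have := ltn_ord k => kN.
by rewrite orbit_frozen_cluster orbit_frozen_column ?pos_part_nat //; lia.
Qed.

Lemma frozen_negE s : frozen_neg v s0 s = 1.
Proof.
rewrite /frozen_neg (reindex (fun k : 'I_N => v k.+1%:Z)) /=; last exact: onW_bij (v_bij v_inj).
apply: big1 => k _; have := ltn_ord k => kN.
rewrite orbit_frozen_column; last by lia.
by rewrite (_ : pos_part _ = 0%N) // /pos_part; lia.
Qed.

End FrozenRows.

(** * Ideal sums as F-polynomials along the mutation sequence *)

Section Labelled.
Variables (n a b c d : nat).
Local Notation N := n.+1.
Hypotheses (a0 : (0 < a)%N) (b0 : (0 < b)%N) (c0 : (0 < c)%N) (d0 : (0 < d)%N).
Hypotheses (abN : (a + b = N)%N) (cdN : (c + d = N)%N).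
Hypothesis cab : c \notin [:: a; b].
Variable v : int -> 'I_N.
Hypothesis v_period : forall i, v (i + N%:Z) = v i.
Hypothesis v_inj : forall i j, 0 < j - i < N%:Z -> v i != v j.

Definition ideal_poly (j : nat) : {mpoly int[N]} :=
  \sum_(I <- order_ideals (gr_poset N a b c d j))
     \prod_(l <- I) 'X_(v (j%:Z - weight a b c d l)).

(** Indexed like the variables: positions 1 to [N] carry initial variables, whose F-polynomial is 1.
    At [N] itself this value comes from the empty poset. *)
Definition F_poly (m : int) : {mpoly int[N]} :=
  if m - N%:Z is Posz j then ideal_poly j else 1.

Definition coef_poly (m : int) : {mpoly int[N]} :=
  \prod_(k < N) 'X_(v k.+1%:Z) ^+ #|` face_int a b c d (m - k.+1%:Z)|.

Let y (k : int) : ratfun int N := tofrac 'X_(v k).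

Lemma tofrac_F_poly m : tofrac (F_poly m) = ideal_sum_int a b c d N y (m - N%:Z).
Proof.
rewrite /F_poly /ideal_sum_int; case: (m - N%:Z) => [j|j]; last exact: tofrac1.
rewrite /ideal_poly /ideal_sum rmorph_sum; apply: eq_bigr => I _.
by rewrite rmorph_prod.
Qed.

Lemma F_poly_rec m : 0 < m -> F_poly m * F_poly (m + N%:Z) =
  coef_poly m * (F_poly (m + a%:Z) * F_poly (m + b%:Z))
  + F_poly (m + c%:Z) * F_poly (m + d%:Z).
Proof.
move=> m0; apply/eqP; rewrite -tofrac_eq; apply/eqP.
rewrite tofracD !tofracM !tofrac_F_poly addrK.
have -> : m + a%:Z - N%:Z = m - b%:Z by lia.
have -> : m + b%:Z - N%:Z = m - a%:Z by lia.
have -> : m + c%:Z - N%:Z = m - d%:Z by lia.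
have -> : m + d%:Z - N%:Z = m - c%:Z by lia.
rewrite mulrC [_ * ideal_sum_int _ _ _ _ _ _ (m - a%:Z)]mulrC.
rewrite [_ * ideal_sum_int _ _ _ _ _ _ (m - c%:Z)]mulrC.
pose pos := @positive_fraction N.
apply: (@ideal_sum_int_rec _ pos a b c d N a0 b0 c0 d0 abN cdN _ _ _ _ _ y _ (fun m => tofrac (coef_poly m))) => //.
- exact: positive_fraction1.
- exact: positive_fraction_neq0.
- exact: positive_fractionD.
- exact: positive_fractionM.
- exact: positive_fractionV.
- by move=> k; apply: positive_fractionX.
- move=> k; apply: (@positive_fraction_neq0 N); rewrite rmorph_prod.
  elim/big_ind: _ => [||i _]; [exact: positive_fraction1|exact: positive_fractionM|].
  rewrite rmorphXn; elim: #|` _| => [|e IH]; first exact: positive_fraction1.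
  by rewrite exprS; apply: positive_fractionM => //; apply: positive_fractionX.
- move=> k k0; rewrite /coef_poly big1 ?tofrac1 // => i _.
  suff -> : face_int a b c d (k - i.+1%:Z) = fset0 by rewrite cardfs0 expr0.
  by apply/fsetP => l; rewrite in_face_int // in_fset0; apply/negP; nia.
move=> k; rewrite -!tofracM.
(* The initial variable is spread over the window with exponents 0 and 1, so that the recursion for
   representations applies to each exponent. *)
have -> : ycoef N y k = tofrac (\prod_(i < N) 'X_(v i.+1%:Z) ^+ (k - i.+1%:Z == 0)).
  rewrite /ycoef; case: ifP => kN; last first.
    rewrite big1 ?tofrac1 // => i _; rewrite (_ : (_ == 0) = false) ?expr0 //.
    by have := ltn_ord i; lia.
  have kN' : (`|k - 1|%N < N)%N by lia.
  rewrite (bigD1 (Ordinal kN')) //= big1 => [|i ik].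
    have -> : (k - `|k - 1|%N.+1%:Z == 0) = true by lia.
    by rewrite mulr1 expr1 /y; congr (tofrac 'X_(v _)); lia.
  rewrite (_ : (_ == 0) = false) ?expr0 //; move/eqP: ik => ik.
  apply/negP => /eqP e; apply: ik; apply: val_inj => /=; lia.
rewrite -tofracM -!big_split /=; congr tofrac; apply: eq_bigr => i _.
rewrite -!exprD; congr (_ ^+ _).
by have := card_face_int_rec a0 b0 c0 d0 cdN (k - i.+1%:Z); rewrite !(addrAC _ (- i.+1%:Z)).
Qed.

Lemma ideal_poly_at1 j :
  (ideal_poly j).@[fun=> 1] = #|` order_ideals (gr_poset N a b c d j)|%:Z.
Proof.
rewrite /ideal_poly raddf_sum /= (eq_bigr (fun=> 1)) => [|I _]; last first.
  by rewrite rmorph_prod big1 // => l _; apply: mevalXU.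
by rewrite big_const_seq count_predT iter_addr_0 natz.
Qed.

Lemma F_poly_at1_neq0 m : (F_poly m).@[fun=> 1] != 0.
Proof.
rewrite /F_poly; case: (m - N%:Z) => j; last by rewrite meval1.
rewrite ideal_poly_at1 eqz_nat cardfs_eq0; apply/fset0Pn; exists fset0.
by apply/order_idealsP; split.
Qed.

Lemma F_poly_neq0 m : F_poly m != 0.
Proof. by apply: contraNneq (F_poly_at1_neq0 m) => ->; rewrite meval0. Qed.

Lemma coef_poly_at1 m : (coef_poly m).@[fun=> 1] = 1.
Proof.
rewrite rmorph_prod big1 // => k _; rewrite rmorphXn /=.
by rewrite mevalXU expr1n.
Qed.

Variable B : 'M[int]_N.
Hypothesis B_exchange : forall i j, 1 <= i <= N%:Z -> 1 <= j <= N%:Z ->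
  B (v i) (v j) = exchange a b c d N i j.
Variable X : int -> ratfun int N.
Hypothesis X_init : forall i, 1 <= i <= N%:Z -> X i = tofrac 'X_(v i).
Hypothesis X_rec : forall m,
  X m * X (m + N%:Z) = X (m + a%:Z) * X (m + b%:Z) + X (m + c%:Z) * X (m + d%:Z).

Lemma F_poly_init i : 1 <= i <= N%:Z -> F_poly i = 1.
Proof.
move=> iN; rewrite /F_poly; case e : (i - N%:Z) => [k|//].
have -> : k = 0%N by lia.
apply/eqP; rewrite -tofrac_eq; apply/eqP; rewrite tofrac1.
have := tofrac_F_poly N%:Z; rewrite /F_poly subrr => -> /=.
exact: ideal_sum0.
Qed.

(** The two claims are carried together: the nonzero value at ones shows that [z] is nonzero, which
    permits the division that identifies the next variable with [X]. *)
Lemma cluster_variable_window j i : 1 <= i <= N%:Z ->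
  let z := cluster_variable B [seq v k%:Z | k <- iota 1 j] (v (j%:Z + i)) in
  z = X (j%:Z + i) /\ at_ones z (F_poly (j%:Z + i)).@[fun=> 1].
Proof.
move=> iN.
have Bex i' j' : 1 <= i' <= N%:Z -> 1 <= j' <= N%:Z ->
    exchange_matrix (trivial_seed B) (lshift 0 (v i')) (v j') = exchange a b c d N i' j'.
  by move=> iN' jN'; rewrite [LHS]col_mxEu B_exchange.
apply: (orbit_cluster_ind a0 b0 c0 d0 abN cdN cab v_period v_inj Bex
  (P := fun m z => z = X m /\ at_ones z (F_poly m).@[fun=> 1])) => // [k kN|].
  rewrite [extended_cluster _]/= row_mxEl mxE X_init //; split=> //.
  have := at_ones_tofrac ('X_(v k) : {mpoly int[N]}).
  by rewrite mevalXU F_poly_init // meval1.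
move=> s z za zb zc zd m [zX z1] [zaX za1] [zbX zb1] [zcX zc1] [zdX zd1].
rewrite /frozen_pos /frozen_neg !big_ord0 !mul1r; split.
  rewrite zaX zbX zcX zdX zX -X_rec mulrC mulKf //.
  by rewrite -zX; apply: at_ones_neq0 z1; apply: F_poly_at1_neq0.
have := congr1 (meval (fun=> 1)) (F_poly_rec (ltac:(done) : 0 < m)).
rewrite mevalD !mevalM coef_poly_at1 mul1r mulrC => e.
apply: at_ones_div e _ z1; first exact: F_poly_at1_neq0.
by apply: at_onesD; apply: at_onesM.
Qed.

Lemma principal_variable_window j i : 1 <= i <= N%:Z ->
  at_ones (principal_variable B [seq v k%:Z | k <- iota 1 j] (v (j%:Z + i)))
    (F_poly (j%:Z + i)).
Proof.
move=> iN.
have Bex i' j' : 1 <= i' <= N%:Z -> 1 <= j' <= N%:Z ->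
    exchange_matrix (principal_seed B) (lshift N (v i')) (v j') = exchange a b c d N i' j'.
  by move=> iN' jN'; rewrite [LHS]col_mxEu B_exchange.
have Bfr u w : exchange_matrix (principal_seed B) (rshift N u) w = (u == w)%:Z.
  by rewrite [LHS]col_mxEd mxE natz.
apply: (orbit_cluster_ind a0 b0 c0 d0 abN cdN cab v_period v_inj Bex
  (P := fun m z => at_ones z (F_poly m))) => // [k kN|].
  rewrite [extended_cluster _]/= row_mxEl mxE F_poly_init //.
  have := at_ones_tofrac ('X_(v k) : {mpoly {mpoly int[N]}[N]}).
  by rewrite mevalXU.
move=> s z za zb zc zd m z1 za1 zb1 zc1 zd1.
rewrite (frozen_negE a0 b0 c0 d0 abN cdN cab v_period v_inj Bex Bfr) mul1r.
rewrite (frozen_posE a0 b0 c0 d0 abN cdN cab v_period v_inj Bex Bfr).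
have := F_poly_rec (ltac:(done) : 0 < m); rewrite mulrC => e.
apply: at_ones_div e _ z1; first exact: F_poly_neq0.
apply: at_onesD; last exact: at_onesM.
apply: at_onesM; last exact: at_onesM.
(* The coefficient is constant in the cluster variables, so evaluation at ones keeps it. *)
have := at_ones_tofrac ((coef_poly m)%:MP : {mpoly {mpoly int[N]}[N]}).
rewrite mevalC; congr at_ones; rewrite /coef_poly !rmorph_prod.
apply: eq_bigr => k _; rewrite !rmorphXn /=; congr (_ ^+ _).
by rewrite row_mxEr mxE.
Qed.

Lemma labelled_main j : (0 < j)%N ->
  let path := [seq v k%:Z | k <- iota 1 j] in
  [/\ cluster_variable B path (v j%:Z) = X (N%:Z + j%:Z),
      at_ones (principal_variable B path (v j%:Z)) (ideal_poly j)
    & at_ones (X (N%:Z + j%:Z)) #|` order_ideals (gr_poset N a b c d j)|%:Z].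
Proof.
move=> j0 path; have NN : 1 <= N%:Z <= N%:Z by lia.
have FE : F_poly (j%:Z + N%:Z) = ideal_poly j by rewrite /F_poly addrK.
(* The vertex mutated last, [v j], occupies the last place of the window, position [j + N]. *)
have [zX z1] := cluster_variable_window j NN.
have p1 := principal_variable_window j NN.
rewrite v_period FE ideal_poly_at1 in zX z1 p1.
by rewrite addrC -zX.
Qed.

End Labelled.

(** * The two directions *)

Section Vertices.
Variable n : nat.
Local Notation N := n.+1.

Lemma val_vertex i : (vertex n i)%:Z = ((i - 1) %% N%:Z)%Z.
Proof.
have m0 : (0 <= (i - 1) %% N%:Z)%Z by apply: modz_ge0.
have mN : ((i - 1) %% N%:Z < N%:Z)%Z by apply: ltz_pmod.
by rewrite /vertex inordK; lia.
Qed.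

Lemma vertexD i : vertex n (i + N%:Z) = vertex n i.
Proof.
by rewrite /vertex (_ : i + N%:Z - 1 = i - 1 + N%:Z) ?modzDr //; lia.
Qed.

Lemma vertex_inj i j : 0 < j - i < N%:Z -> vertex n i != vertex n j.
Proof.
move=> ij; apply/eqP => /(congr1 (fun u : 'I_N => (u : nat)%:Z)).
rewrite !val_vertex => e.
have := divz_eq (i - 1) N%:Z; have := divz_eq (j - 1) N%:Z; rewrite e.
set q := ((i - 1) %/ _)%Z; set q' := ((j - 1) %/ _)%Z => ei ej.
have : (q' - q) * N%:Z = j - i by rewrite mulrBl; lia.
by move=> t; move: ij; rewrite -t pmulr_lgt0 // gtr_pMl //; lia.
Qed.

Lemma label_vertex i : 1 <= i <= N%:Z -> label (vertex n i) = i.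
Proof.
move=> iN; have := val_vertex i; rewrite /label modz_small; last by lia.
by move=> e; rewrite -(addn1 (vertex n i)) PoszD e subrK.
Qed.

Lemma gr_matrix_vertex a b c d i j : 1 <= i <= N%:Z -> 1 <= j <= N%:Z ->
  gr_matrix n a b c d (vertex n i) (vertex n j) = exchange a b c d N i j.
Proof. by move=> iN jN; rewrite mxE /gr_arrows !label_vertex. Qed.

End Vertices.

(* Reading the vertices backwards exchanges the roles of (a, b) and (c, d), which
   is how the sequence N, N - 1, ... is reduced to the sequence 1, 2, .... *)
Lemma arrows_reflect a b c d N i j :
  arrows a b c d N (N%:Z + 1 - i) (N%:Z + 1 - j) = arrows c d a b N i j.
Proof.
have cE p q : corner N p q (N%:Z + 1 - i) (N%:Z + 1 - j) = corner N q p i j.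
  by rewrite /corner; lia.
have pE (p : nat) : (N%:Z + 1 - j == N%:Z + 1 - i + p%:Z) = (j == i - p%:Z) by lia.
have mE (p : nat) : (N%:Z + 1 - j == N%:Z + 1 - i - p%:Z) = (j == i + p%:Z) by lia.
by rewrite /arrows !cE !pE !mE; lia.
Qed.

Lemma exchange_reflect a b c d N i j :
  exchange a b c d N (N%:Z + 1 - i) (N%:Z + 1 - j) = exchange c d a b N i j.
Proof. by rewrite /exchange !arrows_reflect. Qed.

(** * Duality between order filters and order ideals *)

Section Duality.
Variables a b c d N : nat.
Hypotheses (a0 : (0 < a)%N) (b0 : (0 < b)%N) (c0 : (0 < c)%N) (d0 : (0 < d)%N).

(** Negation reverses the order; swapping the two pairs restores the sign conditions and the weight
    for the parameters (c, d, a, b). *)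
Definition dual_quad (l : quad) : quad :=
  let: (l1, l2, l3, l4) := l in (- l3, - l4, - l1, - l2).

Lemma dual_quadK : involutive dual_quad.
Proof. by move=> [[[? ?] ?] ?]; rewrite /= !opprK. Qed.

Lemma weight_dual l : weight c d a b (dual_quad l) = weight a b c d l.
Proof. by case: l => [[[? ?] ?] ?] /=; ring. Qed.

Lemma quad_le_dual l m : quad_le (dual_quad l) (dual_quad m) = quad_le m l.
Proof. by case: l m => [[[? ?] ?] ?] [[[? ?] ?] ?] /=; lia. Qed.

Lemma gr_poset_dual j l :
  (dual_quad l \in gr_poset N c d a b j) = (l \in gr_poset N a b c d j).
Proof. by case: l => [[[? ?] ?] ?]; rewrite !in_gr_poset //=; lia. Qed.

Definition dual_set (S : {fset quad}) : {fset quad} := [fset dual_quad l | l in S].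

Lemma in_dual_set S l : (l \in dual_set S) = (dual_quad l \in S).
Proof.
apply/imfsetP/idP => [[m mS ->]|lS]; first by rewrite dual_quadK.
by exists (dual_quad l); rewrite ?dual_quadK.
Qed.

Lemma dual_setK : involutive dual_set.
Proof. by move=> S; apply/fsetP => l; rewrite !in_dual_set dual_quadK. Qed.

Lemma dual_set_ideal j S : (dual_set S \in order_ideals (gr_poset N c d a b j)) =
  (S \in order_filters (gr_poset N a b c d j)).
Proof.
apply/order_idealsP/order_filtersP => -[/fsubsetP sub cl]; split.
- apply/fsubsetP => l lS; rewrite -gr_poset_dual; apply: sub.
  by rewrite in_dual_set dual_quadK.
- move=> u v uS vP uv; rewrite -(dual_quadK v) -in_dual_set.
  apply: (cl _ (dual_quad u)); rewrite ?gr_poset_dual ?quad_le_dual //.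
  by rewrite in_dual_set dual_quadK.
- apply/fsubsetP => l; rewrite in_dual_set => /sub.
  by rewrite -gr_poset_dual dual_quadK.
move=> u v uP; rewrite !in_dual_set => vS uv; apply: cl vS _ _.
  by rewrite -gr_poset_dual dual_quadK.
by rewrite quad_le_dual.
Qed.

Lemma sum_filters_dual (R : comPzRingType) j (f : int -> R) :
  \sum_(I <- order_ideals (gr_poset N c d a b j)) \prod_(l <- I) f (weight c d a b l) =
  \sum_(S <- order_filters (gr_poset N a b c d j)) \prod_(l <- S) f (weight a b c d l).
Proof.
have inj : injective dual_set := can_inj dual_setK.
rewrite (perm_big (map dual_set (order_filters (gr_poset N a b c d j)))) /=.
  rewrite big_map; apply: eq_bigr => S _.
  rewrite big_imfset /=; last by move=> ? ? _ _; apply: can_inj dual_quadK _ _.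
  by apply: eq_bigr => l _; rewrite weight_dual.
apply: uniq_perm; first exact: fset_uniq.
  by rewrite map_inj_uniq ?fset_uniq.
move=> I; apply/idP/mapP => [II|[S SF ->]]; last by rewrite dual_set_ideal.
by exists (dual_set I); rewrite ?dual_setK // -dual_set_ideal dual_setK.
Qed.

End Duality.

Theorem theorem5p6 (n a b c d : nat)
    (ha : (0 < a)%N) (hb : (0 < b)%N) (hc : (0 < c)%N) (hd : (0 < d)%N)
    (hab : (a + b = n.+1)%N) (hcd : (c + d = n.+1)%N)
    (hgcd : gcdn (gcdn a c) n.+1 = 1%N)
    (hcab : c \notin [:: a; b]) :
  let N := n.+1%:Z in
  forall j : nat, (0 < j)%N ->
  let S := gr_poset n.+1 a b c d j in
  [/\ is_gr_F_polynomial a b c d (1 - j%:Z)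
        (\sum_(R <- order_filters S) \prod_(l <- R)
           (yvar n (weight a b c d l + (N + 1 - j%:Z)))),
      is_gr_F_polynomial a b c d (N + j%:Z)
        (\sum_(I <- order_ideals S) \prod_(l <- I)
           (yvar n (- weight a b c d l + j%:Z)))
    & at_ones (gr_var n a c (N + j%:Z)) (#|` order_ideals S|%:Z)].
Proof.
move=> N j j0 S.
have aN : (a < n.+1)%N by lia.
have cN : (c < n.+1)%N by lia.
have init i : 1 <= i <= N -> gr_var n a c i = tofrac 'X_(vertex n i).
  by move=> iN; rewrite -{1}(label_vertex iN) gr_var_init.
have rec := gr_var_recurrence ha aN hc cN.
have up_rec m : gr_var n a c m * gr_var n a c (m + N) =
    gr_var n a c (m + a%:Z) * gr_var n a c (m + b%:Z)
    + gr_var n a c (m + c%:Z) * gr_var n a c (m + d%:Z).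
  rewrite rec; congr (_ * gr_var n a c _ + _ * gr_var n a c _); lia.
have [up1 up2 up3] := labelled_main ha hb hc hd hab hcd hcab (@vertexD n)
  (@vertex_inj n) (@gr_matrix_vertex n a b c d) init up_rec j0.
(* Under this reversed numbering [v (j - w)] is the vertex [w + (N + 1 - j)], the index in the
   filter formula, and position [N + j] is that of the variable of index [1 - j]. *)
pose v k := vertex n (N + 1 - k).
have v_period i : v (i + N) = v i.
  by rewrite /v -(vertexD _ (_ - (i + N))); congr vertex; lia.
have v_inj i k : 0 < k - i < N -> v i != v k.
  by move=> ik; rewrite eq_sym; apply: vertex_inj; lia.
have v_matrix i k : 1 <= i <= N -> 1 <= k <= N ->
    gr_matrix n a b c d (v i) (v k) = exchange c d a b n.+1 i k.
  by move=> iN kN; rewrite gr_matrix_vertex ?exchange_reflect //; lia.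
have acd : a \notin [:: c; d] by move: hcab; rewrite !inE; lia.
have v_init i : 1 <= i <= N -> gr_var n a c (N + 1 - i) = tofrac 'X_(v i).
  by move=> iN; apply: init; lia.
have v_rec m : gr_var n a c (N + 1 - m) * gr_var n a c (N + 1 - (m + N)) =
    gr_var n a c (N + 1 - (m + c%:Z)) * gr_var n a c (N + 1 - (m + d%:Z))
    + gr_var n a c (N + 1 - (m + a%:Z)) * gr_var n a c (N + 1 - (m + b%:Z)).
  have -> : N + 1 - m = 1 - m + n.+1%:Z by lia.
  have -> : N + 1 - (m + N) = 1 - m by lia.
  rewrite mulrC rec addrC [X in X + _]mulrC [X in _ + X]mulrC.
  by congr (gr_var n a c _ * gr_var n a c _ + gr_var n a c _ * gr_var n a c _); lia.
have [dn1 dn2 _] := labelled_main (X := fun m => gr_var n a c (N + 1 - m))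
  hc hd ha hb hcd hab acd v_period v_inj v_matrix v_init v_rec j0.
have up_path : gr_path n (N + j%:Z) = [seq vertex n k%:Z | k <- iota 1 j].
  rewrite /gr_path ifT; last by lia.
  by congr (map _ (iota 1 _)); lia.
have dn_path : gr_path n (1 - j%:Z) = [seq v k%:Z | k <- iota 1 j].
  rewrite /gr_path ifF; last by lia.
  by congr (map _ (iota 1 _)); lia.
have up_vertex : vertex n (N + j%:Z) = vertex n j%:Z by rewrite addrC vertexD.
have dn_vertex : vertex n (1 - j%:Z) = v j%:Z.
  by rewrite -vertexD; congr vertex; lia.
split=> //; split.
- rewrite dn_path dn_vertex dn1; congr gr_var; lia.
- rewrite dn_path dn_vertex; move: dn2; congr at_ones.
  rewrite -(@sum_filters_dual a b c d n.+1 ha hb hc hd _ j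
    (fun w => yvar n (w + (N + 1 - j%:Z)))).
  apply: eq_bigr => I _; apply: eq_bigr => l _.
  by rewrite /yvar /v; congr 'X_(vertex n _); lia.
- by rewrite up_path up_vertex up1.
rewrite up_path up_vertex; move: up2; congr at_ones.
by apply: eq_bigr => I _; apply: eq_bigr => l _; rewrite addrC.
Qed.
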